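(* Let $\Bbbk$ be an algebraically closed field and let $S=S(1,2)\subset\mathbb{P}^4$ be the smooth rational normal surface scroll, with hyperplane class $H$ and ruling line class $F$. Let $X$ be an effective divisor of $S$ linearly equivalent to $aH+bF$, where either $a=0$ and $b\ge 3$, or $a\ge 1$ and $b\ge 2$. Write each row $(\beta_{0,j},\beta_{1,j},\beta_{2,j},\beta_{3,j})$ of the Betti table $\beta(X)$ as a 4-tuple. Then $\beta(X)$ is the sum of the following rows (all rows not listed are zero, and whenever two of the listed row indices coincide the corresponding 4-tuples are added): (1) If $b=2\delta$ ($\delta \in\mathbb{Z}$): row $2$ is $(3,2,0,0)$; row $a+\delta$ is $(1,0,0,0)$; row $a+\delta+1$ is $(1,6,5,1)$; and for every $j$ with $\delta+2\le j\le b$, row $a+j$ is $(1,3,3,1)$. (2) If $b=2\delta+1$ ($\delta\in\mathbb{Z}$): row $2$ is $(3,2,0,0)$; row $a+\delta+1$ is $(3,6,3,0)$; and for every $j$ with $\delta+2\le j\le b$, row $a+j$ is $(1,3,3,1)$. Moreover $\beta_{i,j}(X)=0$ for $i\ge 4$.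
   Context: For integers $1\le a_1\le a_2$ and $r=a_1+a_2+1$, $S(a_1,a_2)\subset\mathbb{P}^r$ denotes the smooth rational normal surface scroll, i.e. the image of $\mathbb{P}(\mathcal{O}_{\mathbb{P}^1}(a_1)\oplus\mathcal{O}_{\mathbb{P}^1}(a_2))$ under the embedding by the tautological line bundle. Its divisor class group is freely generated by the class $H$ of a hyperplane section and the class $F$ of a ruling line. An effective divisor of $S$ is regarded as a closed subscheme of $\mathbb{P}^r$. Let $R=\Bbbk[x_0,\dots,x_r]$ be the homogeneous coordinate ring of $\mathbb{P}^r$ (here $r=4$). For a closed subscheme $X\subset\mathbb{P}^r$ with homogeneous (saturated) ideal $I(X)\subset R$, the graded Betti numbers are $\beta_{i,j}(X)=\dim_{\Bbbk}\operatorname{Tor}^R_i(I(X),\Bbbk)_{i+j}$, and the Betti table $\beta(X)$ is the table whose entry in column $i$ and row $j$ is $\beta_{i,j}(X)$. *)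

(* Defs.v *)
From mathcomp Require Import all_boot all_order all_algebra.
From mathcomp Require Import ssrcomplements freeg mpoly.

Set Implicit Arguments.
Unset Strict Implicit.
Unset Printing Implicit Defensive.

Import GRing.Theory.
Local Open Scope ring_scope.

(* Ideals are Prop-valued predicates, since membership in an arbitrary ideal
   over an arbitrary field need not be decidable. *)
Section Ideals.
Variables (k : fieldType) (n : nat).
Local Notation R := {mpoly k[n]}.
Implicit Types (I J : R -> Prop).

Definition is_ideal I : Prop :=
  [/\ I 0, (forall f g, I f -> I g -> I (f + g)) & (forall f g, I g -> I (f * g))].

Definition homogeneous I : Prop := forall f d, I f -> I (pihomog mdeg d f).

Definition ideal_gen (A : R -> Prop) : R -> Prop := fun f =>
  exists (m : nat) (c g : 'I_m -> R),
    (forall i, A (g i)) /\ f = \sum_(i < m) c i * g i.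

Definition ideal_add I J : R -> Prop := fun f =>
  exists g h, [/\ I g, J h & f = g + h].

Definition ideal_mul I J : R -> Prop :=
  ideal_gen (fun f => exists g h, [/\ I g, J h & f = g * h]).

Definition ideal_principal (p : R) : R -> Prop := fun f => exists c, f = c * p.

(* Saturation with respect to the irrelevant ideal (x_0, ..., x_{n-1}). *)
Definition sat I : R -> Prop := fun f =>
  exists N : nat, forall m : 'X_{1..n}, mdeg m = N -> I ('X_[m] * f).

(* f |-> I(X) is a bijection between closed subschemes X of P^{n-1} and the
   ideals satisfying this predicate; a closed subscheme is represented by its
   saturated homogeneous ideal. *)
Definition subscheme_ideal I : Prop :=
  [/\ is_ideal I, homogeneous I & forall f, sat I f -> I f].

End Ideals.

(* The scroll S(1,2) in P^4.  P(O(1) + O(2)) is the quotient of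
   (A^2 \ 0) x (A^2 \ 0), with coordinates (s, t; u, v), by the torus acting as
   (s, t; u, v) |-> (l s, l t; l^-1 m u, l^-2 m v); its projection to P^1 is
   (s : t), and the global sections of the tautological line bundle are spanned
   by s u, t u, s^2 v, s t v, t^2 v. *)
Definition scroll_map (A : comNzRingType) (s t u v : A) : 5.-tuple A :=
  [tuple s * u; t * u; s ^+ 2 * v; s * t * v; t ^+ 2 * v].

Section Scroll.
Variable k : fieldType.
Local Notation R := {mpoly k[5]}.
Implicit Types (D E X : R -> Prop).

Definition scroll_ideal : R -> Prop := fun f =>
  f \mPo scroll_map ('X_(inord 0) : {mpoly k[4]}) 'X_(inord 1)
                    'X_(inord 2) 'X_(inord 3) = 0.

Definition scroll_point (p : 5.-tuple k) : Prop :=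
  exists s t u v : k,
    [/\ (s, t) != (0, 0), (u, v) != (0, 0) & p = scroll_map s t u v].

(* X is a closed subscheme of S whose ideal sheaf is generated, in the local
   ring of S at every closed point p, by one nonzero element; that is, X is an
   effective Cartier divisor (equivalently Weil divisor, S being smooth).
   Localizing at p amounts to inverting the forms h with h(p) <> 0. *)
Definition effective_divisor X : Prop :=
  [/\ subscheme_ideal X,
      (forall f, scroll_ideal f -> X f) &
      forall p, scroll_point p ->
        exists (d : nat) (g : R),
          [/\ g \is d.-homog, X g, ~ scroll_ideal g &
              forall f, X f -> exists h : R,
                h.@[tnth p] != 0 /\
                ideal_add (ideal_principal g) scroll_ideal (h * f)]].

(* Sum of effective divisors: the product of the ideal sheaves on S. *)
Definition div_add D E : R -> Prop :=
  sat (ideal_add (ideal_mul D E) scroll_ideal).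

Definition div_zero : R -> Prop := fun _ => True.

Definition div_muln (m : nat) D : R -> Prop := iter m (div_add D) div_zero.

(* The divisor cut out on S by a form p that does not vanish on S. *)
Definition div_form (p : R) : R -> Prop :=
  sat (ideal_add (ideal_principal p) scroll_ideal).

(* D - E = div (q / p) for a nonzero rational function q / p on S. *)
Definition lin_equiv D E : Prop :=
  exists (d : nat) (p q : R),
    [/\ p \is d.-homog, q \is d.-homog, ~ scroll_ideal p, ~ scroll_ideal q &
        forall f, div_add D (div_form p) f <-> div_add E (div_form q) f].

Definition hyperplane_section : R -> Prop := div_form 'X_(inord 0).

(* The fibre over the point (s : t) = (0 : 1) of P^1. *)
Definition ruling_line : R -> Prop := fun f =>
  f \mPo scroll_map (0 : {mpoly k[2]}) 1 'X_(inord 0) 'X_(inord 1) = 0.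

Definition div_aH_bF (a b : nat) : R -> Prop :=
  div_add (div_muln a hyperplane_section) (div_muln b ruling_line).

End Scroll.

Section Betti.
Variables (k : fieldType) (n : nat).
Local Notation R := {mpoly k[n]}.

(* A sequence ... -> F_1 -> F_0 -> R of graded free modules of finite rank:
   F_i has rank fc_rk i and basis elements of degrees fc_deg i.  Elements of F_i
   are row vectors, and fc_d i : F_(i+1) -> F_i acts by right multiplication. *)
Record free_cpx := FreeCpx {
  fc_rk  : nat -> nat;
  fc_deg : forall i, 'I_(fc_rk i) -> nat;
  fc_d   : forall i, 'M[R]_(fc_rk i.+1, fc_rk i);
  fc_aug : 'cV[R]_(fc_rk 0)
}.

Definition graded_free_resolution (I : R -> Prop) (F : free_cpx) : Prop :=
  [/\ (forall c, fc_aug F c 0 \is (fc_deg c).-homog),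
      (forall i (r : 'I_(fc_rk F i.+1)) (c : 'I_(fc_rk F i)),
         ((fc_deg c <= fc_deg r)%N ->
            fc_d F i r c \is (fc_deg r - fc_deg c).-homog) /\
         ((fc_deg r < fc_deg c)%N -> fc_d F i r c = 0)),
      (forall f, I f <-> exists w : 'rV[R]_(fc_rk F 0), f = (w *m fc_aug F) 0 0),
      (forall w : 'rV[R]_(fc_rk F 0),
         w *m fc_aug F = 0 <-> exists x, w = x *m fc_d F 0) &
      (forall i (w : 'rV[R]_(fc_rk F i.+1)),
         w *m fc_d F i = 0 <-> exists x, w = x *m fc_d F i.+1)].

Section Tor.
Variable F : free_cpx.

(* The differential of F tensored with k = R / (x_0, ..., x_{n-1}). *)
Definition fiber_d i : 'M[k]_(fc_rk F i.+1, fc_rk F i) :=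
  map_mx (mcoeff 0%MM) (fc_d F i).

(* Row space: the degree e component of F_i tensored with k. *)
Definition fiber_deg i (e : nat) : 'M[k]_(fc_rk F i) :=
  diag_mx (\row_c (fc_deg c == e)%:R).

Definition fiber_cycles i (e : nat) : 'M[k]_(fc_rk F i) :=
  match i with
  | 0 => fiber_deg 0 e
  | i'.+1 => (fiber_deg i'.+1 e :&: kermx (fiber_d i'))%MS
  end.

Definition fiber_boundaries i (e : nat) : 'M[k]_(fc_rk F i.+1, fc_rk F i) :=
  fiber_deg i.+1 e *m fiber_d i.

Definition dim_tor i (e : nat) : nat :=
  (\rank (fiber_cycles i e) - \rank (fiber_boundaries i e))%N.

End Tor.

(* B is the Betti table of I: B i j = dim_k Tor_i(I, k)_(i + j).  Tor may be
   computed from any graded free resolution; both existence of a resolution and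
   independence of its choice are part of the assertion. *)
Definition is_betti_table (I : R -> Prop) (B : nat -> nat -> nat) : Prop :=
  (exists F, graded_free_resolution I F) /\
  (forall F, graded_free_resolution I F ->
     forall i j, dim_tor F i (i + j) = B i j).

End Betti.

(* The contribution to the entry in column i and row j of a Betti table of the
   4-tuple r placed in row l. *)
Definition row_at (l : nat) (r : 4.-tuple nat) (i j : nat) : nat :=
  if j == l then nth 0%N r i else 0%N.

(* Main.v *)
Require Import Defs.
From mathcomp Require Import all_boot all_order all_algebra.
From mathcomp Require Import ssrcomplements freeg mpoly.
From mathcomp Require Import ring zify.
From Stdlib Require Import ClassicalEpsilon.

(* Let T = k[s,t,u,v] be the Cox ring of S and phi : R -> T the map defining the
   scroll.  Comparing equations in the linear equivalence X + (p) = aH + bF + (q)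
   gives a form G of class aH + bF in T with I(X) = V(G) := {f | G divides phi f}.
   The Betti table of V(G) depends only on the class of G, by induction on b in
   steps of 2: V(G) contains V(v G), of class (a+1)H + (b-2)F, and V(G) / V(v G)
   is generated by one element, of degree a + b, with annihilator the ideal
   (x2, x3, x4) of the line v = 0.  So a resolution of V(G) is assembled from one
   of V(v G) and a Koszul complex, which contributes the row (1,3,3,1); for degree
   reasons it is again minimal.  For b = 0 the quotient V(G) / I(S) is R / I(S)
   up to a shift, and for b = 1 it is the ideal of a ruling line in R / I(S) up to
   a shift; both have explicit resolutions built on the Hilbert-Burch complex. *)

Set Implicit Arguments.
Unset Strict Implicit.
Unset Printing Implicit Defensive.

Import GRing.Theory.
Local Open Scope ring_scope.

(** * Graded matrices and independence of Tor of the resolution *)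

(** The form v has class H - 2F, which is why a step lowers b by 2 and raises a by 1. A cofactor of
    G has F-weight -b, and a monomial of that weight without v is divisible by u^b; hence a lift of
    G u^b generates V(G) modulo V(v G), in degree a + b because u has class H - F. Every step keeps
    a + floor(b/2): this number places the rows of the base case, and the base case needs it to be
    positive. A resolution glued from two minimal ones can fail to be minimal only through a
    constant in a connecting map, that is, through a generator of the smaller ideal in column i and
    one of the quotient in column i + 1 with equal degrees. The rows of V(v G) stop at a + b,
    whereas a constant against the Koszul row a + b would require row a + b + 1. Passing from T back
    to R rests on two facts: a form of F-weight 0 lifts to R, and divisibility in T can be tested
    after multiplication by two coprime monomials, which are chosen so that the products have
    F-weight 0. *)

Section Selection.
Variables (k : fieldType) (n : nat).
Implicit Types (p : {mpoly k[n]}) (P : pred 'X_{1..n}).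

(** With P a condition on degree or weight, this is the corresponding graded component of p. *)
Definition mselect P p : {mpoly k[n]} := \sum_(m <- msupp p | P m) p@_m *: 'X_[m].

Lemma mcoeff_mselect P p m : (mselect P p)@_m = if P m then p@_m else 0.
Proof.
rewrite /mselect raddf_sum /=.
under eq_bigr => i _ do rewrite mcoeffZ mcoeffX.
case: ifP => Pm; last first.
  by rewrite big1 // => i Pi; case: eqP => [ei|]; rewrite ?mulr0 // -ei Pi in Pm *.
have [mp|/memN_msupp_eq0 p0] := boolP (m \in msupp p); last first.
  by rewrite p0 big1 // => i _; case: eqP => [->|]; rewrite ?p0 ?mul0r ?mulr0.
rewrite big_mkcond (bigD1_seq m) ?msupp_uniq //= Pm eqxx mulr1 big1 ?addr0 // => i /negbTE ne.
by rewrite ne mulr0 if_same.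
Qed.

Lemma mem_mselect P p m : (m \in msupp (mselect P p)) = P m && (m \in msupp p).
Proof. by rewrite !mcoeff_msupp mcoeff_mselect; case: (P m); rewrite ?eqxx. Qed.

Lemma mpoly_supp_ind (Q : {mpoly k[n]} -> Prop) p :
  Q 0 -> (forall f g, Q f -> Q g -> Q (f + g)) ->
  (forall m, m \in msupp p -> Q (p@_m *: 'X_[m])) -> Q p.
Proof.
move=> Q0 QD QX; rewrite [p]mpolyE big_seq.
by apply: (big_ind Q) => // m /QX.
Qed.

End Selection.

Section GradedMatrices.
Variables (k : fieldType) (n : nat).
Local Notation R := {mpoly k[n]}.

(** Degree 0 maps of graded free modules, expressed on supports: zero entries satisfy the condition
    by themselves, and no truncated subtraction of degrees occurs. *)
Definition graded_mx m l (dr : 'I_m -> nat) (dc : 'I_l -> nat) (A : 'M[R]_(m, l)) :=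
  forall r c e, e \in msupp (A r c) -> (mdeg e + dc c)%N = dr r.

Lemma graded_mxP m l (dr : 'I_m -> nat) (dc : 'I_l -> nat) (A : 'M[R]_(m, l)) :
  graded_mx dr dc A <->
  (forall r c, ((dc c <= dr r)%N -> A r c \is (dr r - dc c).-homog) /\
               ((dr r < dc c)%N -> A r c = 0)).
Proof.
split=> [gA r c|hA r c e eA].
  split=> [le_d|lt_d].
    by apply/dhomogP => e /gA <-; rewrite addnK.
  apply/eqP; rewrite -msupp_eq0; case E: (msupp _) => [//|e s].
  have := gA r c e; rewrite E mem_head => /(_ isT) ge_d.
  by move: lt_d; rewrite -ge_d ltnNge leq_addl.
have [hom zer] := hA r c; case: (leqP (dc c) (dr r)) => [le_d|/zer A0].
  by have /dhomogP/(_ _ eA) -> := hom le_d; rewrite subnK.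
by move: eA; rewrite A0 msupp0.
Qed.

Lemma graded_mx0 m l (dr : 'I_m -> nat) (dc : 'I_l -> nat) :
  graded_mx dr dc (0 : 'M_(m, l)).
Proof. by move=> r c e; rewrite mxE msupp0. Qed.

Lemma graded_mx1 m (d : 'I_m -> nat) : graded_mx d d 1%:M.
Proof.
move=> r c e; rewrite mxE; case: eqP => [->|_]; last by rewrite msupp0.
by rewrite msupp1 inE => /eqP ->; rewrite mdeg0.
Qed.

Lemma graded_mxD m l (dr : 'I_m -> nat) (dc : 'I_l -> nat) (A B : 'M_(m, l)) :
  graded_mx dr dc A -> graded_mx dr dc B -> graded_mx dr dc (A + B).
Proof.
by move=> gA gB r c e; rewrite mxE => /msuppD_le; rewrite mem_cat => /orP[/gA|/gB].
Qed.

Lemma graded_mxN m l (dr : 'I_m -> nat) (dc : 'I_l -> nat) (A : 'M_(m, l)) :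
  graded_mx dr dc A -> graded_mx dr dc (- A).
Proof. by move=> gA r c e; rewrite mxE (perm_mem (msuppN _)) => /gA. Qed.

Lemma graded_mxB m l (dr : 'I_m -> nat) (dc : 'I_l -> nat) (A B : 'M_(m, l)) :
  graded_mx dr dc A -> graded_mx dr dc B -> graded_mx dr dc (A - B).
Proof. by move=> gA gB; apply/graded_mxD/graded_mxN. Qed.

Lemma graded_mxM m l q (dr : 'I_m -> nat) (dc : 'I_l -> nat) (de : 'I_q -> nat)
    (A : 'M_(m, l)) (B : 'M_(l, q)) :
  graded_mx dr dc A -> graded_mx dc de B -> graded_mx dr de (A *m B).
Proof.
move=> gA gB r c e; rewrite mxE => /msupp_sum_le /flattenP[s /mapP[j _ ->]].
case/msuppM_le/allpairsP=> -[e1 e2] /= [/gA eA /gB eB ->].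
by rewrite mdegD -addnA eB.
Qed.

(** Take any lift and keep in each entry the component of the required degree. What is discarded
    contributes to the product only monomials of wrong degree, while A - B *m D is graded, so the
    error vanishes. *)
Lemma graded_lift m l q (dr : 'I_m -> nat) (dk : 'I_q -> nat) (dc : 'I_l -> nat)
    (D : 'M_(q, l)) (A : 'M_(m, l)) :
  graded_mx dk dc D -> graded_mx dr dc A ->
  (forall r, exists x : 'rV_q, row r A = x *m D) ->
  exists B, graded_mx dr dk B /\ A = B *m D.
Proof.
move=> gD gA /fin_all_exists[x Ax].
pose B : 'M[R]_(m, q) := \matrix_(r, j) mselect (fun e => mdeg e + dk j == dr r)%N (x r 0 j).
have gB : graded_mx dr dk B.
  by move=> r c e; rewrite mxE mem_mselect => /andP[/eqP].
exists B; split=> //; apply/eqP; rewrite -subr_eq0; apply/eqP/matrixP => r c.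
pose E j := x r 0 j - B r j.
have dE : (A - B *m D) r c = \sum_j E j * D j c.
  have := congr1 (fun M : 'rV_l => M 0 c) (Ax r); rewrite 2!mxE => eA.
  by rewrite 3!mxE eA -sumrB; apply: eq_bigr => j _; rewrite mulrBl.
rewrite [RHS]mxE; apply/eqP; rewrite -msupp_eq0.
case eS: (msupp _) => [//|e s].
have eA : e \in msupp ((A - B *m D) r c) by rewrite eS mem_head.
have := graded_mxB gA (graded_mxM gB gD) eA.
move: eA; rewrite dE => /msupp_sum_le /flattenP[s' /mapP[j _ ->]].
case/msuppM_le/allpairsP=> -[e1 e2] /= [eE /gD eD ->].
rewrite mdegD -addnA eD => de; move: eE; rewrite /E mxE mcoeff_msupp mcoeffB.
by rewrite mcoeff_mselect de eqxx subrr eqxx.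
Qed.

Definition fiber_mx m l (A : 'M[R]_(m, l)) : 'M[k]_(m, l) := map_mx (mcoeff 0%MM) A.

Lemma fiber_mxM m l q (A : 'M_(m, l)) (B : 'M_(l, q)) :
  fiber_mx (A *m B) = fiber_mx A *m fiber_mx B.
Proof. exact: (map_mxM (mcoeff 0%MM : {rmorphism R -> k})). Qed.

Lemma fiber_mxD m l (A B : 'M_(m, l)) : fiber_mx (A + B) = fiber_mx A + fiber_mx B.
Proof. exact: (map_mxD (mcoeff 0%MM : {rmorphism R -> k})). Qed.

Lemma fiber_mx0 m l : fiber_mx (0 : 'M_(m, l)) = 0.
Proof. exact: (map_mx0 (mcoeff 0%MM : {rmorphism R -> k})). Qed.

Lemma fiber_mx1 m : fiber_mx (1%:M : 'M_m) = 1%:M.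
Proof. exact: (map_mx1 (mcoeff 0%MM : {rmorphism R -> k})). Qed.

Lemma fiber_mx_eq0 m l (dr : 'I_m -> nat) (dc : 'I_l -> nat) (A : 'M_(m, l)) r c :
  graded_mx dr dc A -> dc c != dr r -> fiber_mx A r c = 0.
Proof.
move=> gA ne; rewrite mxE; apply: memN_msupp_eq0; apply: contra ne => /gA.
by rewrite mdeg0 => /eqP.
Qed.

End GradedMatrices.

Section DegreeProjection.
Variable k : fieldType.

Definition deg_mx m (d : 'I_m -> nat) (e : nat) : 'M[k]_m :=
  diag_mx (\row_c (d c == e)%:R).

Lemma deg_mx_fiber n m l (dr : 'I_m -> nat) (dc : 'I_l -> nat) e
    (A : 'M[{mpoly k[n]}]_(m, l)) :
  graded_mx dr dc A -> deg_mx dr e *m fiber_mx A = fiber_mx A *m deg_mx dc e.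
Proof.
move=> gA; apply/matrixP => r c; rewrite mul_diag_mx mul_mx_diag !mxE.
have [->|ne] := eqVneq (dc c) (dr r); first by rewrite mulrC.
by have := fiber_mx_eq0 gA ne; rewrite mxE => ->; rewrite mul0r mulr0.
Qed.

Lemma deg_mx_id m (d : 'I_m -> nat) e : deg_mx d e *m deg_mx d e = deg_mx d e.
Proof.
rewrite mul_diag_mx; apply/matrixP => r c; rewrite !mxE.
by case: eqP; rewrite ?mul1r ?mul0r ?mul0rn.
Qed.

Lemma sub_deg_mx m l (d : 'I_m -> nat) e (A : 'M_(l, m)) :
  (A <= deg_mx d e)%MS -> A = A *m deg_mx d e.
Proof. by case/submxP => B ->; rewrite -mulmxA deg_mx_id. Qed.

Lemma rank_deg_mx m (d : 'I_m -> nat) e : \rank (deg_mx d e) = #|[pred c | d c == e]|.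
Proof.
pose P := [pred c | d c == e].
(* The rows of A are the coordinate vectors of degree e, so A^T A is the projector and A has full
   row rank. *)
pose A : 'M[k]_(#|P|, m) := \matrix_(i, j) (enum_val i == j)%:R.
have AAt : A *m A^T = 1%:M.
  apply/matrixP => i j; rewrite !mxE (bigD1 (enum_val i)) //= big1.
    by rewrite !mxE eqxx mul1r addr0 (inj_eq enum_val_inj) eq_sym.
  by move=> c; rewrite eq_sym => /negbTE ne; rewrite !mxE ne mul0r.
have AtA : A^T *m A = deg_mx d e.
  apply/matrixP => i j; rewrite !mxE.
  have [Pi|Pi] := boolP (i \in P).
    rewrite (bigD1 (enum_rank_in Pi i)) //= big1 => [|c ne].
      by rewrite !mxE enum_rankK_in // eqxx mul1r addr0 (eqP Pi) eqxx.
    rewrite !mxE; case: eqP => [ei|]; last by rewrite mul0r.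
    by rewrite -[c](enum_valK_in Pi) ei eqxx in ne.
  rewrite big1 => [|c _]; last first.
    rewrite !mxE; case: eqP => [ei|]; last by rewrite mul0r.
    by rewrite -ei enum_valP in Pi.
  by rewrite inE in Pi; rewrite (negbTE Pi) mul0rn.
have rA : row_free A by apply/row_freeP; exists A^T.
by rewrite -AtA mxrankMfree // mxrank_tr; apply/eqP.
Qed.

(** A map Z/B -> Z'/B' with a left inverse is injective. A complement C of B in Z stands for Z/B: f
    is injective on C and its image there meets B' only in 0. *)
Lemma mxrank_subquotient_le m1 m2 m3 m4 l l' (Z : 'M[k]_(m1, l)) (B : 'M_(m2, l))
    (Z' : 'M_(m3, l')) (B' : 'M_(m4, l')) (f : 'M_(l, l')) (g : 'M_(l', l)) :
  (B <= Z)%MS -> (B' <= Z')%MS -> (Z *m f <= Z')%MS -> (B' *m g <= B)%MS ->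
  (Z *m f *m g - Z <= B)%MS -> (\rank Z - \rank B <= \rank Z' - \rank B')%N.
Proof.
move=> sBZ sB'Z' Zf B'g fgB; set C := (Z :\: B)%MS.
have sCZ : (C <= Z)%MS by apply: diffmxSl.
have CB0 : (C :&: B = 0)%MS by apply: diffmx_cap0 || exact: capmx_diff.
have inB q (v : 'M_(q, l)) : (v <= Z)%MS -> (v *m f <= B')%MS -> (v <= B)%MS.
  move=> vZ vf; have -> : v = v *m f *m g - (v *m f *m g - v) by rewrite opprB addrC subrK.
  apply: addmx_sub; first by apply: submx_trans (submxMr g vf) B'g.
  rewrite eqmx_opp; case/submxP: vZ => w ->.
  by rewrite -!mulmxA -mulmxBr mulmxA; apply: submx_trans fgB; apply: submxMl.
have rC : \rank C = (\rank Z - \rank B)%N.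
  rewrite -[X in (_ = X - _)%N](mxrank_cap_compl Z B) -/C.
  have /capmx_idPr eZB := sBZ.
  by rewrite eZB addKn.
have inC q (v : 'M_(q, l)) : (v <= C)%MS -> (v *m f <= B')%MS -> v = 0.
  move=> vC vf; apply/eqP; rewrite -submx0 -CB0 sub_capmx vC.
  by apply: inB => //; apply: submx_trans sCZ.
have rCf : \rank (C *m f) = \rank C.
  apply/mxrank_injP; apply/eqP; apply: inC; first exact: capmxSl.
  have /sub_kermxP -> := capmxSr C (kermx f); exact: sub0mx.
have CfB' : (C *m f :&: B' = 0)%MS.
  have /submxP[w ew] := capmxSl (C *m f) B'.
  rewrite ew mulmxA (inC _ (w *m C)) ?mul0mx ?submxMl //.
  by rewrite -mulmxA -ew capmxSr.
rewrite -rC -rCf -(addnK (\rank B') (\rank (C *m f))) leq_sub2r //.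
rewrite -mxrank_disjoint_sum // mxrankS // addsmx_sub sB'Z' andbT.
by apply: submx_trans Zf; apply: submxMr.
Qed.

End DegreeProjection.

(** * Comparison of graded free resolutions *)

Section Uniqueness.
Variables (k : fieldType) (n : nat).
Local Notation R := {mpoly k[n]}.
Implicit Types (I : R -> Prop) (F G : free_cpx k n).

Lemma resolution_graded_aug I F :
  graded_free_resolution I F -> graded_mx (fc_deg (i := 0)) (fun _ => 0%N) (fc_aug F).
Proof.
case=> ga _ _ _ _; apply/graded_mxP => r c; split=> // _.
by rewrite subn0 (ord1 c).
Qed.

Lemma resolution_graded_d I F i :
  graded_free_resolution I F ->
  graded_mx (fc_deg (i := i.+1)) (fc_deg (i := i)) (fc_d F i).
Proof. by case=> _ gd _ _ _; apply/graded_mxP => r c; apply: gd. Qed.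

Lemma resolution_d_aug I F : graded_free_resolution I F -> fc_d F 0 *m fc_aug F = 0.
Proof.
case=> _ _ _ ex0 _; apply/row_matrixP => r; rewrite row_mul row0.
by apply/ex0; exists (delta_mx 0 r); rewrite rowE.
Qed.

Lemma resolution_dd I F i : graded_free_resolution I F -> fc_d F i.+1 *m fc_d F i = 0.
Proof.
case=> _ _ _ _ exS; apply/row_matrixP => r; rewrite row_mul row0.
by apply/exS; exists (delta_mx 0 r); rewrite rowE.
Qed.

Lemma lift_aug I F m (dr : 'I_m -> nat) (A : 'M_(m, 1)) :
  graded_free_resolution I F -> graded_mx dr (fun _ => 0%N) A ->
  (forall r, I (A r 0)) ->
  exists B, graded_mx dr (fc_deg (i := 0)) B /\ A = B *m fc_aug F.
Proof.
move=> resF gA IA; apply: (graded_lift (resolution_graded_aug resF) gA _) => r.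
have [_ _ + _ _] := resF => /(_ (A r 0))[/(_ (IA r))[x ex] _].
by exists x; apply/matrixP => i j; rewrite (ord1 i) (ord1 j) -ex mxE.
Qed.

Lemma lift_d0 I F m (dr : 'I_m -> nat) (A : 'M_(m, fc_rk F 0)) :
  graded_free_resolution I F -> graded_mx dr (fc_deg (i := 0)) A ->
  A *m fc_aug F = 0 ->
  exists B, graded_mx dr (fc_deg (i := 1)) B /\ A = B *m fc_d F 0.
Proof.
move=> resF gA A0; apply: (graded_lift (resolution_graded_d (i := 0) resF) gA _) => r.
by have [_ _ _ ex0 _] := resF; apply/ex0; rewrite -row_mul A0 row0.
Qed.

Lemma lift_dS I F i m (dr : 'I_m -> nat) (A : 'M_(m, fc_rk F i.+1)) :
  graded_free_resolution I F -> graded_mx dr (fc_deg (i := i.+1)) A ->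
  A *m fc_d F i = 0 ->
  exists B, graded_mx dr (fc_deg (i := i.+2)) B /\ A = B *m fc_d F i.+1.
Proof.
move=> resF gA A0; apply: (graded_lift (resolution_graded_d (i := i.+1) resF) gA _) => r.
by have [_ _ _ _ exS] := resF; apply/exS; rewrite -row_mul A0 row0.
Qed.

(* [chain_at F G i A]: A is the component F_i -> G_i of a graded chain map
   (defined up to level i) that lifts the identity of the resolved ideal. *)
Fixpoint chain_at F G i : 'M[R]_(fc_rk F i, fc_rk G i) -> Prop :=
  match i with
  | 0 => fun A => graded_mx (fc_deg (i := 0)) (fc_deg (i := 0)) A /\
                  A *m fc_aug G = fc_aug F
  | j.+1 => fun A => graded_mx (fc_deg (i := j.+1)) (fc_deg (i := j.+1)) A /\
                     exists2 A', chain_at A' & A *m fc_d G j = fc_d F j *m A'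
  end.

Lemma chain_at_graded F G i (A : 'M_(fc_rk F i, fc_rk G i)) :
  chain_at A -> graded_mx (fc_deg (i := i)) (fc_deg (i := i)) A.
Proof. by case: i A => [|i] A []. Qed.

Lemma chain_at_ex I F G i :
  graded_free_resolution I F -> graded_free_resolution I G ->
  exists A : 'M_(fc_rk F i, fc_rk G i), chain_at A.
Proof.
move=> resF resG; elim: i => [|i [A' cA']].
  have [r|A [gA eA]] := lift_aug resG (resolution_graded_aug resF).
    have [_ _ IF _ _] := resF; apply/IF; exists (delta_mx 0 r).
    by rewrite -rowE mxE.
  by exists A.
have gA' := chain_at_graded cA'.
have gdA := graded_mxM (resolution_graded_d (i := i) resF) gA'.
case: i => [|i] in A' cA' gA' gdA *.
  have [|A [gA eA]] := lift_d0 resG gdA.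
    by case: cA' => _ eA'; rewrite -mulmxA eA' (resolution_d_aug resF).
  by exists A; split=> //; exists A'.
have [|A [gA eA]] := lift_dS resG gdA.
  case: cA' => _ [A'' _ eA'']; rewrite -mulmxA eA'' mulmxA.
  by rewrite (resolution_dd _ resF) mul0mx.
by exists A; split=> //; exists A'.
Qed.

Lemma chain_at_mul F G H i (A : 'M_(fc_rk F i, fc_rk G i)) (B : 'M_(fc_rk G i, fc_rk H i)) :
  chain_at A -> chain_at B -> chain_at (A *m B).
Proof.
elim: i A B => [|i IH] A B [gA cA] [gB cB]; split; try exact: graded_mxM gA gB.
  by rewrite -mulmxA cB.
case: cA cB => A' cA' eA [B' cB' eB]; exists (A' *m B'); first exact: IH.
by rewrite -mulmxA eB !mulmxA eA.
Qed.

(** A - 1 lifts the zero map, hence is null-homotopic. At level 0 the homotopy has one term only,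
    whence the case distinction in the statement. *)
Lemma chain_homotopy I F i (A : 'M_(fc_rk F i, fc_rk F i)) :
  graded_free_resolution I F -> chain_at A ->
  match i return 'M_(fc_rk F i, fc_rk F i) -> Prop with
  | 0 => fun A => exists2 h, graded_mx (fc_deg (i := 0)) (fc_deg (i := 1)) h &
                             A - 1%:M = h *m fc_d F 0
  | j.+1 => fun A => exists h h',
      [/\ graded_mx (fc_deg (i := j.+1)) (fc_deg (i := j.+2)) h,
          graded_mx (fc_deg (i := j)) (fc_deg (i := j.+1)) h' &
          A - 1%:M = h *m fc_d F j.+1 + fc_d F j *m h']
  end A.
Proof.
move=> resF; elim: i A => [|i IH] A [gA cA].
  have [|h [gh eh]] := lift_d0 resF (graded_mxB gA (graded_mx1 (fc_deg (i := 0)))).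
    by rewrite mulmxBl cA mul1mx subrr.
  by exists h.
case: cA => A' cA' eA.
(* Of the homotopy one level down only its upper term is kept; the other one dies on composition
   with the differential. *)
have [h' gh' eh'] : exists2 h', graded_mx (fc_deg (i := i)) (fc_deg (i := i.+1)) h' &
    fc_d F i *m (A' - 1%:M) = fc_d F i *m h' *m fc_d F i.
  case: i => [|i] in A IH gA A' cA' eA *.
    by have [h gh ->] := IH _ cA'; exists h; rewrite ?mulmxA.
  have [h [h' [gh _ ->]]] := IH _ cA'; exists h => //.
  by rewrite mulmxDr !mulmxA (resolution_dd _ resF) mul0mx addr0.
have gB := graded_mxB (graded_mxB gA (graded_mx1 (fc_deg (i := i.+1))))
             (graded_mxM (resolution_graded_d (i := i) resF) gh').
have [|h [gh eh]] := lift_dS resF gB.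
  by rewrite !mulmxBl mul1mx eA -eh' mulmxBr mulmx1 subrr.
by exists h, h'; split=> //; rewrite -eh subrK.
Qed.

Lemma fiber_degE F i e : fiber_deg F i e = deg_mx k (fc_deg (i := i)) e.
Proof. by []. Qed.

Lemma cycles_sub_deg F i e : (fiber_cycles F i e <= deg_mx k (fc_deg (i := i)) e)%MS.
Proof. by case: i => [|i] //=; apply: capmxSl. Qed.

Lemma boundaries_sub_cycles I F i e :
  graded_free_resolution I F -> (fiber_boundaries F i e <= fiber_cycles F i e)%MS.
Proof.
move=> resF; have gd := resolution_graded_d (i := i) resF.
have : (fiber_boundaries F i e <= deg_mx k (fc_deg (i := i)) e)%MS.
  by rewrite /fiber_boundaries fiber_degE (deg_mx_fiber e gd) submxMl.
case: i {gd} => [|i] dd //=; rewrite sub_capmx dd; apply/sub_kermxP.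
rewrite /fiber_boundaries -mulmxA.
have := congr1 (@fiber_mx k n _ _) (resolution_dd i resF).
by rewrite fiber_mxM fiber_mx0 /fiber_d => ->; rewrite mulmx0.
Qed.

Lemma chain_at_cycles F G i e (A : 'M_(fc_rk F i, fc_rk G i)) : chain_at A ->
  (fiber_cycles F i e *m fiber_mx A <= fiber_cycles G i e)%MS.
Proof.
move=> cA; have gA := chain_at_graded cA.
have gdeg : (deg_mx k (fc_deg (i := i)) e *m fiber_mx A <= deg_mx k (fc_deg (i := i)) e)%MS.
  by rewrite (deg_mx_fiber e gA) submxMl.
case: i A cA {gA} gdeg => [|i] A cA gdeg //=.
rewrite sub_capmx; apply/andP; split.
  by apply: submx_trans gdeg; apply: submxMr; apply: capmxSl.
case: cA => _ [A' _ eA']; apply/sub_kermxP; rewrite -mulmxA.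
have := congr1 (@fiber_mx k n _ _) eA'; rewrite !fiber_mxM /fiber_d => ->; rewrite mulmxA.
have /sub_kermxP -> := capmxSr (fiber_deg F i.+1 e) (kermx (fiber_mx (fc_d F i))).
by rewrite mul0mx.
Qed.

(** In the homotopy formula one term lands in the boundaries and the other begins with the
    differential, so it is zero on cycles. *)
Lemma chain_at_cycles_id I F i e (A : 'M_(fc_rk F i, fc_rk F i)) :
  graded_free_resolution I F -> chain_at A ->
  (fiber_cycles F i e *m fiber_mx A - fiber_cycles F i e <= fiber_boundaries F i e)%MS.
Proof.
move=> resF cA; have hA := chain_homotopy resF cA.
have sub_b h : graded_mx (fc_deg (i := i)) (fc_deg (i := i.+1)) h ->
    (fiber_cycles F i e *m fiber_mx h *m fiber_d F i <= fiber_boundaries F i e)%MS.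
  move=> gh; rewrite (sub_deg_mx (cycles_sub_deg F i e)) -(mulmxA _ (deg_mx _ _ _)).
  by rewrite (deg_mx_fiber e gh) -!mulmxA mulmxA; apply: submxMl.
have -> : fiber_cycles F i e *m fiber_mx A - fiber_cycles F i e =
          fiber_cycles F i e *m fiber_mx (A - 1%:M).
  have fA := fiber_mxD (A - 1%:M) 1%:M; rewrite subrK fiber_mx1 in fA.
  by rewrite fA mulmxDr mulmx1 addrK.
case: i A {cA} hA sub_b => [|i] A hA sub_b.
  by case: hA => h gh ->; rewrite fiber_mxM mulmxA; apply: sub_b.
case: hA => h [h' [gh gh' ->]]; rewrite fiber_mxD !fiber_mxM mulmxDr.
have /sub_kermxP Zd := capmxSr (fiber_deg F i.+1 e) (kermx (fiber_d F i)).
rewrite !mulmxA -[fiber_mx (fc_d F i)]/(fiber_d F i) [X in X *m fiber_mx h']Zd.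
by rewrite mul0mx addr0; apply: sub_b.
Qed.

Lemma dim_tor_le I F G i e :
  graded_free_resolution I F -> graded_free_resolution I G ->
  (dim_tor F i e <= dim_tor G i e)%N.
Proof.
move=> resF resG.
(* Maps are taken at level [i.+1]: the commuting square between levels i and i + 1 is what carries
   boundaries to boundaries. *)
have [A1 [_ [A cA _]]] := chain_at_ex i.+1 resF resG.
have [B1 [gB1 [B cB eB]]] := chain_at_ex i.+1 resG resF.
apply: (@mxrank_subquotient_le _ _ _ _ _ _ _ _ _ _ _ (fiber_mx A) (fiber_mx B)).
- exact: boundaries_sub_cycles resF.
- exact: boundaries_sub_cycles resG.
- exact: chain_at_cycles.
- rewrite /fiber_boundaries -mulmxA.
  have := congr1 (@fiber_mx k n _ _) eB; rewrite !fiber_mxM /fiber_d => <-.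
  by rewrite mulmxA (deg_mx_fiber e gB1) -mulmxA submxMl.
by rewrite -mulmxA -fiber_mxM; apply: chain_at_cycles_id resF (chain_at_mul cA cB).
Qed.

Lemma dim_tor_unique I F G i e :
  graded_free_resolution I F -> graded_free_resolution I G ->
  dim_tor F i e = dim_tor G i e.
Proof. by move=> resF resG; apply/eqP; rewrite eqn_leq !(dim_tor_le (I := I)). Qed.

Definition minimal_cpx F := forall i, fiber_d F i = 0.

Lemma dim_tor_minimal F i e :
  minimal_cpx F -> dim_tor F i e = #|[pred c | fc_deg (f := F) (i := i) c == e]|.
Proof.
move=> minF; rewrite /dim_tor /fiber_boundaries minF mulmx0 mxrank0 subn0.
rewrite -(rank_deg_mx k); case: i => [|i] //=.
rewrite minF; set Z := fiber_deg F i.+1 e.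
have /capmx_idPl -> // : (Z <= kermx (0 : 'M[k]_(_, fc_rk F i)))%MS.
by apply/sub_kermxP; apply: mulmx0.
Qed.

Lemma betti_table_of_minimal I F B :
  graded_free_resolution I F -> minimal_cpx F ->
  (forall i j, #|[pred c | fc_deg (f := F) (i := i) c == (i + j)%N]| = B i j) ->
  is_betti_table I B.
Proof.
move=> resF minF cF; split; first by exists F.
by move=> G resG i j; rewrite (dim_tor_unique i _ resG resF) dim_tor_minimal.
Qed.

End Uniqueness.

(** * The horseshoe construction *)

Section SumDegrees.

Definition sum_deg m n (d1 : 'I_m -> nat) (d2 : 'I_n -> nat) (c : 'I_(m + n)) : nat :=
  match split c with inl c1 => d1 c1 | inr c2 => d2 c2 end.

Lemma sum_deg_lshift m n (d1 : 'I_m -> nat) (d2 : 'I_n -> nat) c :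
  sum_deg d1 d2 (lshift n c) = d1 c.
Proof. by rewrite /sum_deg (unsplitK (inl c)). Qed.

Lemma sum_deg_rshift m n (d1 : 'I_m -> nat) (d2 : 'I_n -> nat) c :
  sum_deg d1 d2 (rshift m c) = d2 c.
Proof. by rewrite /sum_deg (unsplitK (inr c)). Qed.

Lemma card_sum_deg m n (d1 : 'I_m -> nat) (d2 : 'I_n -> nat) e :
  #|[pred c | sum_deg d1 d2 c == e]| =
  (#|[pred c | d1 c == e]| + #|[pred c | d2 c == e]|)%N.
Proof.
rewrite -!sum1_card big_split_ord /=; congr (_ + _)%N; apply: eq_bigl => c.
  by rewrite !inE sum_deg_lshift.
by rewrite !inE sum_deg_rshift.
Qed.

End SumDegrees.

Section Horseshoe.
Variables (k : fieldType) (n : nat).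
Local Notation R := {mpoly k[n]}.
Implicit Types (I J : R -> Prop) (F N : free_cpx k n).

Lemma graded_block m1 m2 l1 l2 (dr1 : 'I_m1 -> nat) (dr2 : 'I_m2 -> nat)
    (dc1 : 'I_l1 -> nat) (dc2 : 'I_l2 -> nat) (A : 'M[R]_(m1, l1)) (B : 'M_(m1, l2))
    (C : 'M_(m2, l1)) (D : 'M_(m2, l2)) :
  graded_mx dr1 dc1 A -> graded_mx dr1 dc2 B -> graded_mx dr2 dc1 C ->
  graded_mx dr2 dc2 D ->
  graded_mx (sum_deg dr1 dr2) (sum_deg dc1 dc2) (block_mx A B C D).
Proof.
move=> gA gB gC gD r c e.
case: (split_ordP r) => r' ->; case: (split_ordP c) => c' ->;
  rewrite ?sum_deg_lshift ?sum_deg_rshift.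
- by rewrite block_mxEul => /gA.
- by rewrite block_mxEur => /gB.
- by rewrite block_mxEdl => /gC.
- by rewrite block_mxEdr => /gD.
Qed.

(* A resolution of the quotient (J + I') / J, where I' is generated by the
   entries of [fc_aug N] and I = J + I'. *)
Definition relative_resolution J I N : Prop :=
  [/\ graded_mx (fc_deg (i := 0)) (fun _ => 0%N) (fc_aug N),
      (forall i, graded_mx (fc_deg (i := i.+1)) (fc_deg (i := i)) (fc_d N i)),
      (forall f, I f <-> exists j (w : 'rV_(fc_rk N 0)), J j /\ f = j + (w *m fc_aug N) 0 0),
      (forall w : 'rV_(fc_rk N 0),
         J ((w *m fc_aug N) 0 0) <-> exists x, w = x *m fc_d N 0) &
      (forall i (w : 'rV_(fc_rk N i.+1)),
         w *m fc_d N i = 0 <-> exists x, w = x *m fc_d N i.+1)].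

Lemma relative_resolution0 I N :
  relative_resolution (fun f => f = 0) I N -> graded_free_resolution I N.
Proof.
case=> ga gd In ex0 exS; split=> //.
- move=> c; have /graded_mxP/(_ c 0)[+ _] := ga; rewrite subn0; exact.
- by move=> i r c; have /graded_mxP := gd i; apply.
- move=> f; rewrite In; split=> [[j [w [-> ->]]]|[w ->]].
    by exists w; rewrite add0r.
  by exists 0, w; rewrite add0r.
move=> w; rewrite -ex0; split=> [->|w0]; first by rewrite mxE.
by apply/matrixP => i j; rewrite (ord1 i) (ord1 j) w0 mxE.
Qed.

Section Construction.
Variables (I J : R -> Prop) (F N : free_cpx k n).
Hypotheses (resF : graded_free_resolution J F) (resN : relative_resolution J I N).

(** The lower left block of the glued differential; its equation makes the lower left block of two
    consecutive differentials vanish. Each stage is a lift depending on the previously chosen one,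
    so the choices are made by [epsilon] inside the recursion. *)
Fixpoint connecting_map i : 'M[R]_(fc_rk N i.+1, fc_rk F i) :=
  match i return 'M[R]_(fc_rk N i.+1, fc_rk F i) with
  | 0 => epsilon (inhabits 0) (fun B =>
           graded_mx (fc_deg (i := 1)) (fc_deg (i := 0)) B /\
           B *m fc_aug F = - (fc_d N 0 *m fc_aug N))
  | j.+1 => epsilon (inhabits 0) (fun B =>
           graded_mx (fc_deg (i := j.+2)) (fc_deg (i := j.+1)) B /\
           B *m fc_d F j = - (fc_d N j.+1 *m connecting_map j))
  end.

Lemma relative_dd i : fc_d N i.+1 *m fc_d N i = 0.
Proof.
have [_ _ _ _ exS] := resN; apply/row_matrixP => r; rewrite row_mul row0.
by apply/exS; exists (delta_mx 0 r); rewrite rowE.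
Qed.

Lemma connecting_map0P :
  graded_mx (fc_deg (i := 1)) (fc_deg (i := 0)) (connecting_map 0) /\
  connecting_map 0 *m fc_aug F = - (fc_d N 0 *m fc_aug N).
Proof.
have [ga gd _ ex0 _] := resN.
suff ex_B : exists B, graded_mx (fc_deg (i := 1)) (fc_deg (i := 0)) B /\
    B *m fc_aug F = - (fc_d N 0 *m fc_aug N).
  exact: (epsilon_spec (inhabits 0) _ ex_B).
have [r|B [gB eB]] := lift_aug resF (graded_mxN (graded_mxM (gd 0%N) ga)).
  suff Jr : J ((row r (fc_d N 0) *m fc_aug N) 0 0).
    have [_ _ JF _ _] := resF; apply/JF; move/JF: Jr => [w ew].
    exists (- w); rewrite mulNmx [RHS]mxE -ew.
    by rewrite [LHS]mxE -row_mul [in RHS]mxE.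
  by apply/ex0; exists (delta_mx 0 r); rewrite rowE.
by exists B.
Qed.

Lemma connecting_mapSP i :
  graded_mx (fc_deg (i := i.+2)) (fc_deg (i := i.+1)) (connecting_map i.+1) /\
  connecting_map i.+1 *m fc_d F i = - (fc_d N i.+1 *m connecting_map i).
Proof.
have [ga gd _ ex0 _] := resN.
suff ex_i : exists B, graded_mx (fc_deg (i := i.+2)) (fc_deg (i := i.+1)) B /\
    B *m fc_d F i = - (fc_d N i.+1 *m connecting_map i).
  exact: (epsilon_spec (inhabits 0) _ ex_i).
(* The induction is on mere existence; [epsilon_spec] turns existence at one level into the equation
   needed at the next. *)
elim: i => [|i IH].
  have [g0 e0] := connecting_map0P.
  have [|B [gB eB]] := lift_d0 resF (graded_mxN (graded_mxM (gd 1%N) g0)).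
    by rewrite mulNmx -mulmxA e0 mulmxN opprK mulmxA relative_dd mul0mx.
  by exists B.
have [g1 e1] : graded_mx (fc_deg (i := i.+2)) (fc_deg (i := i.+1)) (connecting_map i.+1) /\
    connecting_map i.+1 *m fc_d F i = - (fc_d N i.+1 *m connecting_map i).
  exact: (epsilon_spec (inhabits 0) _ IH).
have [|B [gB eB]] := lift_dS resF (graded_mxN (graded_mxM (gd i.+2) g1)).
  by rewrite mulNmx -mulmxA e1 mulmxN opprK mulmxA relative_dd mul0mx.
by exists B.
Qed.

Lemma connecting_map_graded i :
  graded_mx (fc_deg (i := i.+1)) (fc_deg (i := i)) (connecting_map i).
Proof. by case: i => [|i]; [have [] := connecting_map0P | have [] := connecting_mapSP i]. Qed.

Definition horseshoe : free_cpx k n :=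
  @FreeCpx k n (fun i => fc_rk F i + fc_rk N i)%N
    (fun i => sum_deg (fc_deg (f := F) (i := i)) (fc_deg (f := N) (i := i)))
    (fun i => block_mx (fc_d F i) 0 (connecting_map i) (fc_d N i))
    (col_mx (fc_aug F) (fc_aug N)).

(** A syzygy is lifted in two stages: its N-part by exactness of N, and then its F-part, which
    becomes a syzygy of F once the connecting map applied to the first lift is subtracted. *)
Lemma horseshoe_resolution : graded_free_resolution I horseshoe.
Proof.
have [gaN gdN IN ex0N exSN] := resN; have [_ _ JF ex0F exSF] := resF.
have [_ e0] := connecting_map0P.
apply: relative_resolution0; split.
- move=> r c e /=; case: (split_ordP r) => r' -> /=.
    by rewrite col_mxEu sum_deg_lshift; apply: (resolution_graded_aug resF).
  by rewrite col_mxEd sum_deg_rshift; apply: gaN.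
- move=> i; apply: graded_block => //; first exact: resolution_graded_d resF.
    exact: graded_mx0.
  exact: connecting_map_graded.
- move=> f; rewrite IN; split=> [[j [w [/JF[x ->] ->]]]|[_ [w [-> ->]]]].
    exists 0, (row_mx x w); split=> //.
    by rewrite add0r [fc_aug _]/= mul_row_col [RHS]mxE.
  rewrite add0r -[w](hsubmxK (n1 := fc_rk F 0)) [fc_aug _]/= mul_row_col.
  exists ((lsubmx w *m fc_aug F) 0 0), (rsubmx w); split; last by rewrite mxE.
  by apply/JF; exists (lsubmx w).
- move=> w; rewrite -[w](hsubmxK (n1 := fc_rk F 0)) [fc_aug _]/= [fc_d _ _]/= mul_row_col.
  set w1 := lsubmx _; set w2 := rsubmx _; split.
    move=> h; have h' : w1 *m fc_aug F + w2 *m fc_aug N = 0.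
      by apply/matrixP => i j; rewrite (ord1 i) (ord1 j) h mxE.
    have [x2 ex2] : exists x, w2 = x *m fc_d N 0.
      apply/ex0N/JF; exists (- w1); rewrite mulNmx.
      by move/eqP: h'; rewrite addrC addr_eq0 => /eqP ->.
    have [x1 ex1] : exists x, w1 - x2 *m connecting_map 0 = x *m fc_d F 0.
      by apply/ex0F; rewrite mulmxBl -mulmxA e0 mulmxN mulmxA -ex2 opprK.
    exists (row_mx x1 x2); rewrite mul_row_block mulmx0 add0r -ex2 -ex1.
    by rewrite subrK.
  case=> x; rewrite -[x](hsubmxK (n1 := fc_rk F 1)) mul_row_block mulmx0 add0r.
  case/eq_row_mx => -> ->; rewrite mulmxDl -!mulmxA e0.
  by rewrite (resolution_d_aug resF) mulmx0 add0r mulmxN addNr mxE.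
move=> i w; have [_ eS] := connecting_mapSP i.
rewrite -[w](hsubmxK (n1 := fc_rk F i.+1)) [fc_d _ i]/= [fc_d _ i.+1]/= mul_row_block.
set w1 := lsubmx _; set w2 := rsubmx _; rewrite mulmx0 add0r; split.
  rewrite -[0](row_mx0 _ _ (fc_rk F i) (fc_rk N i)) => /eq_row_mx[e1 /exSN[x2 ex2]].
  have [x1 ex1] : exists x, w1 - x2 *m connecting_map i.+1 = x *m fc_d F i.+1.
    by apply/exSF; rewrite mulmxBl -mulmxA eS mulmxN mulmxA -ex2 opprK.
  exists (row_mx x1 x2); rewrite mul_row_block mulmx0 add0r -ex2 -ex1.
  by rewrite subrK.
case=> x; rewrite -[x](hsubmxK (n1 := fc_rk F i.+2)) mul_row_block mulmx0 add0r.
case/eq_row_mx => -> ->; rewrite mulmxDl -!mulmxA eS relative_dd !mulmx0.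
by rewrite (resolution_dd _ resF) mulmx0 add0r mulmxN addNr row_mx0.
Qed.

End Construction.

Definition has_minimal_resolution I (b : nat -> nat -> nat) : Prop :=
  exists F, [/\ graded_free_resolution I F, minimal_cpx F &
                forall i e, #|[pred c | fc_deg (f := F) (i := i) c == e]| = b i e].

(** Besides the two minimal differentials only the connecting map enters. It has a nonzero constant
    entry only if a generator of N in column i + 1 has the degree of a generator of F in column i,
    which the last hypothesis excludes. *)
Lemma horseshoe_minimal I J N bJ bN :
  has_minimal_resolution J bJ -> relative_resolution J I N -> minimal_cpx N ->
  (forall i e, #|[pred c | fc_deg (f := N) (i := i) c == e]| = bN i e) ->
  (forall i e, bN i.+1 e != 0%N -> bJ i e = 0%N) ->
  has_minimal_resolution I (fun i e => bJ i e + bN i e)%N.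
Proof.
move=> [F [resF minF cF]] resN minN cN disj; exists (horseshoe F N); split.
- exact: (horseshoe_resolution resF resN).
- move=> i; rewrite /fiber_d [fc_d _ _]/= map_block_mx -/(fiber_d F i) -/(fiber_d N i).
  rewrite minF minN map_mx0 (_ : map_mx _ _ = 0) ?block_mx0 //.
  apply/matrixP => r c; rewrite [RHS]mxE.
  apply: (fiber_mx_eq0 (connecting_map_graded resF resN (i := i))).
  apply/eqP => eqd; have /(disj i (fc_deg r)) : bN i.+1 (fc_deg r) != 0%N.
    by rewrite -cN -lt0n; apply/card_gt0P; exists r; rewrite inE.
  by rewrite -cF; apply/eqP; rewrite -lt0n; apply/card_gt0P; exists c; rewrite inE eqd.
by move=> i e; rewrite card_sum_deg cF cN.
Qed.

End Horseshoe.

(** * Complexes of length at most 3 generated in one degree per column *)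

Section PureComplexes.
Variables (k : fieldType) (n : nat).
Local Notation R := {mpoly k[n]}.
Variables (n0 n1 n2 n3 : nat) (e : nat -> nat).
Variables (D0 : 'M[R]_(n1, n0)) (D1 : 'M[R]_(n2, n1)) (D2 : 'M[R]_(n3, n2)).
Variable (A : 'cV[R]_n0).

Definition pure_rk i := nth 0%N [:: n0; n1; n2; n3] i.

Definition pure_cpx : free_cpx k n :=
  @FreeCpx k n pure_rk (fun i _ => e i)
    (fun i => match i return 'M[R]_(pure_rk i.+1, pure_rk i) with
              | 0 => D0 | 1 => D1 | 2 => D2 | _ => 0 end) A.

Hypotheses (e_lt : forall i, (e i < e i.+1)%N)
  (gA : graded_mx (fun _ => e 0%N) (fun _ => 0%N) A)
  (g0 : graded_mx (fun _ => e 1%N) (fun _ => e 0%N) D0)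
  (g1 : graded_mx (fun _ => e 2%N) (fun _ => e 1%N) D1)
  (g2 : graded_mx (fun _ => e 3%N) (fun _ => e 2%N) D2).

Lemma pure_graded i : graded_mx (fc_deg (f := pure_cpx) (i := i.+1)) (fc_deg (i := i)) (fc_d pure_cpx i).
Proof. by case: i => [|[|[|i]]] //; apply: graded_mx0. Qed.

Lemma pure_minimal : minimal_cpx pure_cpx.
Proof.
move=> i; apply/matrixP => r c; rewrite [RHS]mxE.
by apply: (fiber_mx_eq0 (pure_graded (i := i))) => /=; rewrite neq_ltn e_lt.
Qed.

Lemma card_pure i x :
  #|[pred c | fc_deg (f := pure_cpx) (i := i) c == x]| = (if e i == x then pure_rk i else 0)%N.
Proof.
case: ifP => ex; last by apply: eq_card0 => c.
by rewrite -[RHS]card_ord; apply: eq_card => c.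
Qed.

Lemma pure_relative_resolution J I :
  (forall f, I f <-> exists j (w : 'rV_n0), J j /\ f = j + (w *m A) 0 0) ->
  (forall w : 'rV_n0, J ((w *m A) 0 0) <-> exists x, w = x *m D0) ->
  (forall w : 'rV_n1, w *m D0 = 0 <-> exists x, w = x *m D1) ->
  (forall w : 'rV_n2, w *m D1 = 0 <-> exists x, w = x *m D2) ->
  (forall w : 'rV_n3, w *m D2 = 0 -> w = 0) ->
  relative_resolution J I pure_cpx.
Proof.
move=> hI h0 h1 h2 h3; split=> //; first exact: pure_graded.
case=> [|[|[|i]]] //= w.
  split=> [/h3 ->|[x ->]]; first by exists 0; rewrite mul0mx.
  by rewrite mulmx0 mul0mx.
have -> : w = 0 by apply/rowP => -[j lt_j]; exfalso; rewrite /pure_rk /= nth_nil in lt_j.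
by split=> _; [exists 0; rewrite mul0mx | rewrite mul0mx].
Qed.

End PureComplexes.

(** * Exactness of small complexes *)

Section ListMatrices.
Variable R : nzRingType.
Implicit Types (s : seq R) (t : seq (seq R)).

(** Vectors and matrices are given by lists, with 0 for missing entries, so that matrix products
    unfold to polynomial identities accessible to [ring]. *)
Definition rowl n s : 'rV[R]_n := \row_(j < n) s`_j.
Definition seqmx m n t : 'M[R]_(m, n) := \matrix_(i < m, j < n) (nth [::] t i)`_j.

Lemma rowl_ex n (w : 'rV_n) : exists2 s, size s = n & w = rowl n s.
Proof.
exists [seq w 0 j | j <- enum 'I_n]; first by rewrite size_map size_enum_ord.
apply/rowP => j; rewrite mxE (nth_map j) ?size_enum_ord //.
by rewrite nth_ord_enum.
Qed.

End ListMatrices.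

Section Exactness.
Variable R : idomainType.

(** y1 is a nonzerodivisor modulo y2; in [regular3], y3 is one modulo (y1, y2). *)
Definition regular2 (y1 y2 : R) := forall a b, a * y1 = b * y2 -> exists c, a = c * y2.
Definition regular3 (y1 y2 y3 : R) :=
  forall a b c, a * y1 + b * y2 + c * y3 = 0 -> exists p q, c = p * y1 + q * y2.

Definition koszul0 (y1 y2 y3 : R) : 'M_(3, 1) := seqmx 3 1 [:: [:: y1]; [:: y2]; [:: y3]].
Definition koszul1 (y1 y2 y3 : R) : 'M_3 :=
  seqmx 3 3 [:: [:: y2; - y1; 0]; [:: y3; 0; - y1]; [:: 0; y3; - y2]].
Definition koszul2 (y1 y2 y3 : R) : 'M_(1, 3) := seqmx 1 3 [:: [:: y3; - y2; y1]].

Lemma koszul_syz1 y1 y2 y3 a b c : y2 != 0 -> regular2 y1 y2 -> regular3 y1 y2 y3 ->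
  a * y1 + b * y2 + c * y3 = 0 ->
  exists p q r, [/\ a = p * y2 + q * y3, b = - p * y1 + r * y3 & c = - q * y1 - r * y2].
Proof.
move=> nz2 r2 r3 e; have [p [q ec]] := r3 _ _ _ e.
have [z ez] : exists z, a + p * y3 = z * y2.
  apply: (r2 _ (- (b + q * y3))); apply/eqP; rewrite -subr_eq0 -[X in _ == X]e ec.
  by apply/eqP; ring.
have ez' : b + q * y3 = - z * y1.
  apply: (mulIf nz2); rewrite [RHS](_ : _ = - (a + p * y3) * y1); last by rewrite ez; ring.
  by apply/eqP; rewrite -subr_eq0 -[X in _ == X]e ec; apply/eqP; ring.
exists z, (- p), (- q); split; last by rewrite ec; ring.
  by rewrite -ez; ring.
by rewrite -ez'; ring.
Qed.

Lemma koszul_syz2 y1 y2 y3 p q r : y3 != 0 -> regular2 y2 y3 ->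
  p * y2 + q * y3 = 0 -> - p * y1 + r * y3 = 0 ->
  exists z, [/\ p = z * y3, q = - z * y2 & r = z * y1].
Proof.
move=> nz3 r2 e1 e2.
have [z ez] : exists z, p = z * y3.
  by apply: (r2 _ (- q)); apply/eqP; rewrite -subr_eq0 -[X in _ == X]e1; apply/eqP; ring.
exists z; split=> //; apply: (mulIf nz3).
  by apply/eqP; rewrite -subr_eq0 -[X in _ == X]e1 ez; apply/eqP; ring.
by apply/eqP; rewrite -subr_eq0 -[X in _ == X]e2 ez; apply/eqP; ring.
Qed.

Ltac entries := rewrite ?mxE ?big_ord_recl ?big_ord0 ?mxE /=.

Lemma koszul_exact1 y1 y2 y3 (w : 'rV_3) :
  y2 != 0 -> regular2 y1 y2 -> regular3 y1 y2 y3 ->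
  (w *m koszul0 y1 y2 y3) 0 0 = 0 <-> exists x, w = x *m koszul1 y1 y2 y3.
Proof.
move=> nz2 r2 r3; have [s sz ->] := rowl_ex w; case: s sz => [|a [|b [|c [|? ?]]]] // _; split.
  entries; rewrite addr0 addrA => /(koszul_syz1 nz2 r2 r3)[p [q [r [-> -> ->]]]].
  exists (rowl 3 [:: p; q; r]); apply/rowP; case=> [[|[|[|]]] //= lt_j]; entries; ring.
case=> x ->; have [s sz ->] := rowl_ex x; case: s sz => [|p [|q [|r [|? ?]]]] // _.
by entries; entries; ring.
Qed.

Lemma koszul_exact2 y1 y2 y3 (w : 'rV_3) : y3 != 0 -> regular2 y2 y3 ->
  w *m koszul1 y1 y2 y3 = 0 <-> exists x, w = x *m koszul2 y1 y2 y3.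
Proof.
move=> nz3 r2; have [s sz ->] := rowl_ex w; case: s sz => [|p [|q [|r [|? ?]]]] // _; split.
  move/rowP => e; have := e ord0; have := e (fintype.lift ord0 ord0); entries => e2 e1.
  have [|| z [-> -> ->]] := @koszul_syz2 y1 y2 y3 p q r nz3 r2.
  - by rewrite -[RHS]e1; ring.
  - by rewrite -[RHS]e2; ring.
  by exists (rowl 1 [:: z]); apply/rowP; case=> [[|[|[|]]] //= lt_j]; entries; ring.
case=> x ->; have [s sz ->] := rowl_ex x; case: s sz => [|z [|? ?]] // _.
by apply/rowP; case=> [[|[|[|]]] //= lt_j]; do 3! entries; ring.
Qed.

Lemma koszul_exact3 y1 y2 y3 (w : 'rV_1) : y3 != 0 -> w *m koszul2 y1 y2 y3 = 0 -> w = 0.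
Proof.
move=> nz3; have [s sz ->] := rowl_ex w; case: s sz => [|z [|? ?]] // _ => /rowP/(_ ord0).
entries; rewrite addr0 => /eqP; rewrite mulf_eq0 (negbTE nz3) orbF => /eqP ->.
by apply/rowP => -[[|] //= lt_j]; entries.
Qed.

Section Scroll.
Variables x0 x1 x2 x3 x4 : R.

(* The 2 x 2 minors of the matrix (x0 x2 x3 / x1 x3 x4). *)
Definition minor1 : R := x0 * x3 - x1 * x2.
Definition minor2 : R := x0 * x4 - x1 * x3.
Definition minor3 : R := x2 * x4 - x3 ^+ 2.

Definition minors_mx : 'M_(3, 1) := seqmx 3 1 [:: [:: minor1]; [:: minor2]; [:: minor3]].
(** Each row is a syzygy of the minors: it expands the 3 x 3 determinant obtained by repeating a row
    of the 2 x 3 matrix. *)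
Definition hilbert_burch_mx : 'M_(2, 3) :=
  seqmx 2 3 [:: [:: x3; - x2; x0]; [:: x4; - x3; x1]].

(** Every syzygy of the three minors is a combination of the two rows of [hilbert_burch_mx]. *)
Definition minors_independent := forall a b c,
  a * minor1 + b * minor2 + c * minor3 = 0 ->
  exists l m, [/\ a = l * x3 + m * x4, b = - l * x2 - m * x3 & c = l * x0 + m * x1].

Lemma hilbert_burch_exact1 (w : 'rV_3) : minors_independent ->
  (w *m minors_mx) 0 0 = 0 <-> exists x, w = x *m hilbert_burch_mx.
Proof.
move=> ind; have [s sz ->] := rowl_ex w; case: s sz => [|a [|b [|c [|? ?]]]] // _; split.
  entries; rewrite addr0 addrA => /ind[l [m [-> -> ->]]].
  by exists (rowl 2 [:: l; m]); apply/rowP; case=> [[|[|[|]]] //= lt_j]; entries; ring.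
case=> x ->; have [s sz ->] := rowl_ex x; case: s sz => [|l [|m [|? ?]]] // _.
by do 2! entries; rewrite /minor1 /minor2 /minor3; ring.
Qed.

Lemma hilbert_burch_exact2 (w : 'rV_2) : minor3 != 0 -> x3 != 0 ->
  w *m hilbert_burch_mx = 0 -> w = 0.
Proof.
move=> nzq nz3; have [s sz ->] := rowl_ex w; case: s sz => [|l [|m [|? ?]]] // _ => /rowP e.
have := e ord0; have := e (fintype.lift ord0 ord0); entries => e2 e1.
(* The first two columns of [hilbert_burch_mx] have determinant [minor3]; eliminating m leaves l
   times it. *)
have l0 : l = 0.
  apply: (mulIf nzq); rewrite mul0r /minor3.
  have -> : l * (x2 * x4 - x3 ^+ 2) = - x4 * (l * - x2 + (m * - x3 + 0))
     - x3 * (l * x3 + (m * x4 + 0)) by ring.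
  by rewrite e1 e2 !mulr0 subrr.
have m0 : m = 0 by apply: (mulIf nz3); move: e2; rewrite l0 => e2; rewrite mul0r -[RHS]oppr0 -e2; ring.
by apply/rowP => -[[|[|]] //= lt_j]; entries; rewrite ?l0 ?m0.
Qed.

(* Mapping cone of the inclusion of the ideal of the minors into (x0, x2, x3):
   it resolves the quotient (x0, x2, x3) / (minors). *)
Definition cone_mx0 : 'M_(6, 3) :=
  seqmx 6 3 [:: [:: x2; - x0; 0]; [:: x3; 0; - x0]; [:: 0; x3; - x2];
                [:: x3; - x1; 0]; [:: x4; 0; - x1]; [:: 0; x4; - x3]].
(** The first row is the second Koszul syzygy of (x0, x2, x3). The other two carry the rows of
    [hilbert_burch_mx] in their right halves, and their left halves compensate on the Koszul
    side. *)
Definition cone_mx1 : 'M_(3, 6) :=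
  seqmx 3 6 [:: [:: x3; - x2; x0; 0; 0; 0]; [:: x4; - x3; x1; x3; - x2; x0];
                [:: 0; 0; 0; x4; - x3; x1]].

Hypotheses (nz0 : x0 != 0) (nz2 : x2 != 0) (nz3 : x3 != 0) (nzq : minor3 != 0)
  (r02 : regular2 x0 x2) (r23 : regular2 x2 x3) (r023 : regular3 x0 x2 x3)
  (ind : minors_independent).

Lemma cone_exact0 (w : 'rV_3) :
  (exists h : 'rV_3, (w *m koszul0 x0 x2 x3) 0 0 = (h *m minors_mx) 0 0) <->
  exists x, w = x *m cone_mx0.
Proof.
have [s sz ->] := rowl_ex w; case: s sz => [|a [|b [|c [|? ?]]]] // _; split.
  case=> h; have [s sz ->] := rowl_ex h; case: s sz => [|h1 [|h2 [|h3 [|? ?]]]] // _.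
  entries; rewrite /minor1 /minor2 /minor3 => e.
  have [|p [q [r [ea eb ec]]]] := @koszul_syz1 x0 x2 x3 (a - (h1 * x3 + h2 * x4))
     (b - (- h1 * x1 + h3 * x4)) (c - (- h2 * x1 - h3 * x3)) nz2 r02 r023.
    by move/eqP: e; rewrite -subr_eq0 => /eqP e; rewrite -[RHS]e; ring.
  exists (rowl 6 [:: p; q; r; h1; h2; h3]); apply/rowP; case=> [[|[|[|]]] //= lt_j]; entries.
  - by rewrite -[LHS](subrK (h1 * x3 + h2 * x4)) ea; ring.
  - by rewrite -[LHS](subrK (- h1 * x1 + h3 * x4)) eb; ring.
  - by rewrite -[LHS](subrK (- h2 * x1 - h3 * x3)) ec; ring.
case=> x ->; have [s sz ->] := rowl_ex x; case: s sz => [|p [|q [|r [|h1 [|h2 [|h3 [|? ?]]]]]]] // _.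
by exists (rowl 3 [:: h1; h2; h3]); do 2! entries; rewrite /minor1 /minor2 /minor3; ring.
Qed.

Lemma cone_exact1 (w : 'rV_6) : w *m cone_mx0 = 0 <-> exists x, w = x *m cone_mx1.
Proof.
have [s sz ->] := rowl_ex w; case: s sz => [|p [|q [|r [|h1 [|h2 [|h3 [|? ?]]]]]]] // _; split.
  move/rowP => e; have := e (fintype.lift ord0 (fintype.lift ord0 ord0)).
  have := e ord0; have := e (fintype.lift ord0 ord0); entries => e2 e1 e3.
  (* Weighting the three equations by x0, x2, x3 cancels the Koszul part and leaves a syzygy of the
     minors. *)
  have [|l [m [eh1 eh2 eh3]]] := ind (a := h1) (b := h2) (c := h3).
    rewrite [LHS](_ : _ = x0 * (p * x2 + q * x3 + h1 * x3 + h2 * x4)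
      + x2 * (- p * x0 + r * x3 - h1 * x1 + h3 * x4)
      + x3 * (- q * x0 - r * x2 - h2 * x1 - h3 * x3)); last first.
      by rewrite /minor1 /minor2 /minor3; ring.
    have -> : p * x2 + q * x3 + h1 * x3 + h2 * x4 = 0 by rewrite -[RHS]e1; ring.
    have -> : - p * x0 + r * x3 - h1 * x1 + h3 * x4 = 0 by rewrite -[RHS]e2; ring.
    have -> : - q * x0 - r * x2 - h2 * x1 - h3 * x3 = 0 by rewrite -[RHS]e3; ring.
    by rewrite !mulr0 !addr0.
  (* After removal of l times the second row and m times the third, only a syzygy of the Koszul
     relations remains. *)
  have [|| z [ep eq er]] := @koszul_syz2 x0 x2 x3 (p - l * x4) (q + l * x3) (r - l * x1) nz3 r23.
  - by rewrite -[RHS]e1 eh1 eh2; ring.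
  - by rewrite -[RHS]e2 eh1 eh3; ring.
  exists (rowl 3 [:: z; l; m]); apply/rowP.
  case=> [[|[|[|[|[|[|]]]]]] //= lt_j]; entries; rewrite ?eh1 ?eh2 ?eh3; try ring.
  - by rewrite -[LHS](subrK (l * x4)) ep; ring.
  - by rewrite -[LHS](addrK (l * x3)) eq; ring.
  - by rewrite -[LHS](subrK (l * x1)) er; ring.
case=> x ->; have [s sz ->] := rowl_ex x; case: s sz => [|z [|l [|m [|? ?]]]] // _.
by apply/rowP; case=> [[|[|[|]]] //= lt_j]; do 3! entries; ring.
Qed.

Lemma cone_exact2 (w : 'rV_3) : w *m cone_mx1 = 0 -> w = 0.
Proof.
have [s sz ->] := rowl_ex w; case: s sz => [|z [|l [|m [|? ?]]]] // _ => /rowP e.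
have e3 := e (fintype.lift ord0 (fintype.lift ord0 (fintype.lift ord0 ord0))).
have e4 := e (fintype.lift ord0 (fintype.lift ord0 (fintype.lift ord0 (fintype.lift ord0 ord0)))).
have e1 := e ord0; move: e1 e3 e4; entries => e1 e3 e4.
(* The last three columns involve only l and m, through [hilbert_burch_mx]. *)
have : rowl 2 [:: l; m] = 0.
  apply: hilbert_burch_exact2 nzq nz3 _; apply/rowP.
  have e5 := e (fintype.lift ord0 (fintype.lift ord0 (fintype.lift ord0 (fintype.lift ord0 (fintype.lift ord0 ord0))))).
  move: e5; entries => e5.
  case=> [[|[|[|]]] //= lt_j]; entries.
  - by rewrite -[RHS]e3; ring.
  - by rewrite -[RHS]e4; ring.
  - by rewrite -[RHS]e5; ring.
move/rowP => lm; have := lm ord0; have := lm (fintype.lift ord0 ord0); entries => m0 l0.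
have z0 : z = 0 by apply: (mulIf nz3); rewrite mul0r -e1 l0 m0; ring.
by apply/rowP => -[[|[|[|]]] //= lt_j]; entries; rewrite ?z0 ?l0 ?m0.
Qed.

End Scroll.
End Exactness.

(** * Ideals of polynomial rings and toric kernels *)

Section Ideals.
Variables (k : fieldType) (n : nat).
Local Notation R := {mpoly k[n]}.
Implicit Types (I : R -> Prop) (f g : R).

Lemma ideal0 I : is_ideal I -> I 0. Proof. by case. Qed.
Lemma idealD I f g : is_ideal I -> I f -> I g -> I (f + g). Proof. by case=> _ h _; apply: h. Qed.
Lemma idealM I f g : is_ideal I -> I g -> I (f * g). Proof. by case=> _ _ h; apply: h. Qed.
Lemma ideal_sum I (J : Type) (r : seq J) (P : pred J) (F : J -> R) :
  is_ideal I -> (forall j, P j -> I (F j)) -> I (\sum_(j <- r | P j) F j).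
Proof. by move=> idI IF; apply: (big_ind I) => // [|f g]; [apply: ideal0 | apply: idealD]. Qed.

Lemma ideal_subst I l f :
  is_ideal I -> (forall i, I ('X_i - tnth l i)) -> I (f - (f \mPo l)).
Proof.
move=> idI IX.
have Imul a b c d : I (a - b) -> I (c - d) -> I (a * c - b * d).
  move=> Iab Icd; have -> : a * c - b * d = c * (a - b) + b * (c - d) by ring.
  by apply: idealD => //; apply: idealM.
have I1 : I (1 - 1) by rewrite subrr; apply: ideal0.
apply: (mpoly_supp_ind (Q := fun f => I (f - (f \mPo l)))) => [|a b Ia Ib|m _].
- by rewrite /= comp_mpoly0 subrr; apply: ideal0.
- by rewrite /= comp_mpolyD opprD addrACA; apply: idealD.
rewrite /= comp_mpolyZ -scalerBr -mul_mpolyC; apply: idealM => //.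
rewrite comp_mpolyX mpolyXE_id; apply: (big_ind2 (fun a b => I (a - b))) => //.
move=> i _; elim: (m i) => [|d IH]; first by rewrite !expr0.
by rewrite !exprS; apply: Imul.
Qed.

Lemma principal_ideal f : is_ideal (ideal_principal f).
Proof.
split; first by exists 0; rewrite mul0r.
  by move=> _ _ [a ->] [b ->]; exists (a + b); rewrite mulrDl.
by move=> g _ [a ->]; exists (g * a); rewrite mulrA.
Qed.

End Ideals.

Section KillVariable.
Variables (k : fieldType) (n : nat).
Local Notation R := {mpoly k[n]}.
Implicit Types (f g : R) (i j : 'I_n).

(** Setting a variable to 0, as an endomorphism of the same ring: its kernel is the ideal of the
    variable and its target is a domain, so regularity of the variables follows by applying it to
    equations. *)
Definition kill_var i : R -> R :=
  fun f => f \mPo [tuple (if j == i then 0 else 'X_j) | j < n].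

Lemma kill_varM i f g : kill_var i (f * g) = kill_var i f * kill_var i g.
Proof. exact: rmorphM. Qed.
Lemma kill_varD i f g : kill_var i (f + g) = kill_var i f + kill_var i g.
Proof. exact: comp_mpolyD. Qed.
Lemma kill_varB i f g : kill_var i (f - g) = kill_var i f - kill_var i g.
Proof. exact: comp_mpolyB. Qed.
Lemma kill_var_exp i f d : kill_var i (f ^+ d) = kill_var i f ^+ d.
Proof. exact: rmorphXn. Qed.
Lemma kill_varX i j : kill_var i 'X_j = if j == i then 0 else 'X_j.
Proof. by rewrite /kill_var comp_mpolyXU -tnth_nth tnth_mktuple. Qed.

Lemma kill_varE i f : exists g, f = kill_var i f + g * 'X_i.
Proof.
have [|g eg] := ideal_subst (l := [tuple (if j == i then 0 else 'X_j) | j < n]) f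
                  (principal_ideal ('X_i : R)).
  move=> j; rewrite tnth_mktuple; case: eqP => [->|_].
    by exists 1; rewrite subr0 mul1r.
  by exists 0; rewrite subrr mul0r.
by exists g; rewrite -eg /kill_var addrC subrK.
Qed.

Lemma mpolyX_neq0 m : ('X_[m] : R) != 0.
Proof. by rewrite -msupp_eq0 msuppX. Qed.

Lemma kill_var_eq0 i f : kill_var i f = 0 -> exists g, f = g * 'X_i.
Proof. by move=> f0; have [g eg] := kill_varE i f; exists g; rewrite {1}eg f0 add0r. Qed.

Lemma regular2_vars i j : i != j -> regular2 ('X_i : R) 'X_j.
Proof.
move=> ne a b /(congr1 (kill_var j)); rewrite !kill_varM !kill_varX eqxx (negbTE ne) mulr0.
by move=> /eqP; rewrite mulf_eq0 (negbTE (mpolyX_neq0 _)) orbF => /eqP/kill_var_eq0.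
Qed.

Lemma kill_var2_eq0 i j f : kill_var j (kill_var i f) = 0 ->
  exists p q, f = p * 'X_i + q * 'X_j.
Proof.
move=> /kill_var_eq0[q eq]; have [p ep] := kill_varE i f.
by exists p, q; rewrite ep eq addrC.
Qed.

Lemma regular3_vars i j l : i != l -> j != l -> i != j ->
  regular3 ('X_i : R) 'X_j 'X_l.
Proof.
move=> nil njl nij a b c /(congr1 (kill_var i))/(congr1 (kill_var j)).
rewrite !(kill_varD, kill_varM, kill_varX) eqxx.
have -> : (j == i) = false by rewrite eq_sym (negbTE nij).
have -> : (l == i) = false by rewrite eq_sym (negbTE nil).
have kj0 x : kill_var x 0 = 0 by apply: comp_mpoly0.
rewrite !kj0 !kill_varX eqxx.
have -> : (l == j) = false by rewrite eq_sym (negbTE njl).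
rewrite !mulr0 !add0r => /eqP; rewrite mulf_eq0 (negbTE (mpolyX_neq0 _)) orbF.
by move=> /eqP/kill_var2_eq0.
Qed.

Lemma var_pow_dvd i d f g h : kill_var i g != 0 ->
  f * g = 'X_i ^+ d * h -> exists f', f = 'X_i ^+ d * f'.
Proof.
move=> nzg; elim: d f h => [|d IH] f h e; first by exists f; rewrite expr0 mul1r.
have /kill_var_eq0[f1 ef1] : kill_var i f = 0.
  have := congr1 (kill_var i) e; rewrite !kill_varM kill_var_exp kill_varX eqxx exprS !mul0r.
  by move=> /eqP; rewrite mulf_eq0 (negbTE nzg) orbF => /eqP.
have [f' ef'] : exists f', f1 = 'X_i ^+ d * f'.
  apply: (IH _ h); apply: (mulfI (mpolyX_neq0 U_(i))).
  by rewrite [RHS]mulrA -exprS -e ef1; ring.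
by exists f'; rewrite ef1 ef' exprS; ring.
Qed.

End KillVariable.

Section Toric.
Variables (k : fieldType) (n l : nat).

(* [s] selects a monomial in each fibre of the exponent map [E]: if every
   monomial is congruent to the selected one of its fibre modulo I, then I
   contains the kernel. *)
Lemma toric_kernel (lq : n.-tuple {mpoly k[l]}) (E : 'X_{1..n} -> 'X_{1..l})
    (s : 'X_{1..l} -> 'X_{1..n}) (I : {mpoly k[n]} -> Prop) f :
  is_ideal I -> (forall m, 'X_[m] \mPo lq = 'X_[E m]) ->
  (forall m, I ('X_[m] - 'X_[s (E m)])) -> f \mPo lq = 0 -> I f.
Proof.
(* L is the linear map sending the monomial m to the monomial s m, cut off at a degree bound K valid
   for all images of monomials of f so that it is a finite sum. Then f = f - L (f \mPo lq) is a sum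
   of the given congruences. *)
move=> idI hE hs f0; set K := (\max_(m <- msupp f) (mdeg (E m))).+1.
pose L (g : {mpoly k[l]}) : {mpoly k[n]} := \sum_(m : 'X_{1..l < K}) g@_m *: 'X_[s m].
have L_lin c g h : L (c *: g + h) = c *: L g + L h.
  rewrite /L scaler_sumr -big_split; apply: eq_bigr => m _.
  by rewrite mcoeffD mcoeffZ scalerDl scalerA.
have LX m : m \in msupp f -> L 'X_[E m] = 'X_[s (E m)].
  move=> mf; have ltK : (mdeg (E m) < K)%N by rewrite ltnS; apply: leq_bigmax_seq.
  rewrite /L (bigD1 (Sub (E m) ltK)) //= mcoeffX eqxx scale1r big1 ?addr0 // => m' ne.
  rewrite mcoeffX; case: eqP => [e|]; last by rewrite scale0r.
  by case/eqP: ne; apply/val_inj; rewrite /= -e.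
have L0 : L 0 = 0 by rewrite /L big1 // => m _; rewrite mcoeff0 scale0r.
have Lf : L (f \mPo lq) = \sum_(m <- msupp f) f@_m *: 'X_[s (E m)].
  rewrite comp_mpolyEX.
  have : {subset msupp f <= msupp f} by [].
  elim: {1 3 4}(msupp f) => [|m r IH] sub; first by rewrite !big_nil.
  rewrite !big_cons L_lin IH => [|m' m'r]; last first.
    by apply: sub; rewrite inE m'r orbT.
  by rewrite hE LX // sub ?mem_head.
rewrite -[f]subr0 -L0 -f0 Lf {1}[f]mpolyE -sumrB; apply: ideal_sum => // m _.
by rewrite -scalerBr -mul_mpolyC; apply: idealM.
Qed.

End Toric.

(** * Weights, monomials and the minors *)

Section Weights.
Variables (k : fieldType) (n : nat) (w : 'X_{1..n} -> int).
Hypothesis wD : forall m m', w (m + m')%MM = w m + w m'.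
Local Notation R := {mpoly k[n]}.
Implicit Types f g : R.

Definition weight_homog (z : int) f := forall m, m \in msupp f -> w m = z.

Lemma weight_homogX m z : w m = z -> weight_homog z 'X_[m].
Proof. by move=> <- m' /mem_msuppXP ->. Qed.

Lemma weight_homogM a b f g :
  weight_homog a f -> weight_homog b g -> weight_homog (a + b) (f * g).
Proof.
move=> hf hg m /msuppM_le/allpairsP[[m1 m2] /= [/hf <- /hg <- ->]].
exact: wD.
Qed.

Lemma weight_homog1 : weight_homog 0 1.
Proof.
move=> m; rewrite msupp1 inE => /eqP ->.
by apply: (addrI (w 0%MM)); rewrite -wD addm0 addr0.
Qed.

Lemma weight_homog_exp a f d : weight_homog a f -> weight_homog (a *+ d) (f ^+ d).
Proof.
move=> hf; elim: d => [|d IH]; first exact: weight_homog1.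
by rewrite exprS mulrS; apply: weight_homogM.
Qed.

(** Let g2 be the part of g of weight different from b. Then f g2 has no monomial of weight a + b,
    yet as a difference of two forms of weight a + b it has no other monomial either; so f g2 = 0
    and g2 = 0. *)
Lemma weight_homog_quotient a b f g : f != 0 ->
  weight_homog a f -> weight_homog (a + b) (f * g) -> weight_homog b g.
Proof.
move=> nzf hf hfg.
have hg1 : weight_homog b (mselect (fun m => w m == b) g).
  by move=> m; rewrite mem_mselect => /andP[/eqP].
set g2 := mselect (fun m => w m != b) g.
have dg : g = mselect (fun m => w m == b) g + g2.
  by apply/mpolyP => m; rewrite mcoeffD !mcoeff_mselect; case: eqP; rewrite ?addr0 ?add0r.
have /eqP : f * g2 = 0.
  apply/eqP; rewrite -msupp_eq0; case E: (msupp _) => [//|m r]; exfalso.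
  have m2 : m \in msupp (f * g2) by rewrite E mem_head.
  have m1 : w m = a + b.
    move: m2; have -> : f * g2 = f * g - f * mselect (fun m => w m == b) g.
      by rewrite -mulrBr [X in X - _]dg addrAC subrr add0r.
    by move/msuppB_le; rewrite mem_cat => /orP[/hfg|/(weight_homogM hf hg1)].
  case/msuppM_le/allpairsP: m2 => -[e1 e2] /= [/hf h1]; rewrite mem_mselect => /andP[ne _] em.
  by case/eqP: ne; apply: (addrI a); rewrite -m1 em wD h1.
rewrite mulf_eq0 (negbTE nzf) /= => /eqP g20 m mg; apply/eqP/negPn/negP => ne.
by have := mem_mselect (fun m => w m != b) g m; rewrite -/g2 g20 msupp0 ne mg.
Qed.

End Weights.

Section CompositionLemmas.
Variables (k : fieldType).

Lemma comp_mpolyA n l l' (f : {mpoly k[n]}) (lq : n.-tuple {mpoly k[l]})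
    (lr : l.-tuple {mpoly k[l']}) :
  (f \mPo lq) \mPo lr = f \mPo [tuple (tnth lq i) \mPo lr | i < n].
Proof.
rewrite !(comp_mpolyEX f) raddf_sum; apply: eq_bigr => m _ /=.
rewrite comp_mpolyZ !comp_mpolyX rmorph_prod; congr (_ *: _).
by apply: eq_bigr => i _; rewrite rmorphXn tnth_mktuple.
Qed.

Lemma comp_scroll_map l l' (f : {mpoly k[5]}) (s t u v : {mpoly k[l]})
    (lr : l.-tuple {mpoly k[l']}) :
  (f \mPo scroll_map s t u v) \mPo lr =
  f \mPo scroll_map (s \mPo lr) (t \mPo lr) (u \mPo lr) (v \mPo lr).
Proof.
rewrite comp_mpolyA; congr (_ \mPo _); apply: eq_from_tnth => i; rewrite tnth_mktuple.
by case: i => [[|[|[|[|[|]]]]] //= lt_i]; rewrite !(tnth_nth 0) /= ?rmorphM ?rmorphXn.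
Qed.

End CompositionLemmas.

Section Monomials.

Definition mn4 (p q i j : nat) : 'X_{1..4} := [multinom [tuple p; q; i; j]].
Definition mn5 (a b c d e : nat) : 'X_{1..5} := [multinom [tuple a; b; c; d; e]].

Lemma mn4E p q i j : ((mn4 p q i j (inord 0) = p) * (mn4 p q i j (inord 1) = q) *
  (mn4 p q i j (inord 2) = i) * (mn4 p q i j (inord 3) = j))%type.
Proof. by rewrite !(mnm_nth 0%N) !inordK. Qed.

Lemma mn5E a b c d e : ((mn5 a b c d e (inord 0) = a) * (mn5 a b c d e (inord 1) = b) *
  (mn5 a b c d e (inord 2) = c) * (mn5 a b c d e (inord 3) = d) *
  (mn5 a b c d e (inord 4) = e))%type.
Proof. by rewrite !(mnm_nth 0%N) !inordK. Qed.

Lemma mn4_ex (m : 'X_{1..4}) : exists p q i j, m = mn4 p q i j.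
Proof.
exists (m (inord 0)), (m (inord 1)), (m (inord 2)), (m (inord 3)); apply/mnmP => j.
rewrite [RHS](mnm_nth 0%N); case: j => [[|[|[|[|]]]] //= lt_j];
  by congr (m _); apply/val_inj; rewrite /= inordK.
Qed.

Lemma mn5_ex (m : 'X_{1..5}) : exists a b c d e, m = mn5 a b c d e.
Proof.
exists (m (inord 0)), (m (inord 1)), (m (inord 2)), (m (inord 3)), (m (inord 4)).
apply/mnmP => j.
rewrite [RHS](mnm_nth 0%N); case: j => [[|[|[|[|[|]]]]] //= lt_j];
  by congr (m _); apply/val_inj; rewrite /= inordK.
Qed.

Lemma mdeg_mn5 a b c d e : mdeg (mn5 a b c d e) = (a + b + c + d + e)%N.
Proof. by rewrite mdegE !big_ord_recl big_ord0 !(mnm_nth 0%N) /= addn0 !addnA. Qed.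

Variable k : fieldType.

Lemma mpolyX_mn4 p q i j : 'X_[mn4 p q i j] =
  'X_(inord 0) ^+ p * 'X_(inord 1) ^+ q * 'X_(inord 2) ^+ i * 'X_(inord 3) ^+ j
  :> {mpoly k[4]}.
Proof.
rewrite mpolyXE_id !big_ord_recl big_ord0 mulr1 !mulrA !(mnm_nth 0%N) /=.
have e0 : ord0 = inord 0 :> 'I_4 by apply/val_inj; rewrite /= inordK.
have e1 : fintype.lift ord0 ord0 = inord 1 :> 'I_4 by apply/val_inj; rewrite /= inordK.
have e2 : fintype.lift ord0 (fintype.lift ord0 ord0) = inord 2 :> 'I_4 by apply/val_inj; rewrite /= inordK.
have e3 : fintype.lift ord0 (fintype.lift ord0 (fintype.lift ord0 ord0)) = inord 3 :> 'I_4.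
  by apply/val_inj; rewrite /= inordK.
by rewrite e3 e2 e1 e0.
Qed.

Lemma mpolyX_mn5 a b c d e : 'X_[mn5 a b c d e] =
  'X_(inord 0) ^+ a * 'X_(inord 1) ^+ b * 'X_(inord 2) ^+ c * 'X_(inord 3) ^+ d
  * 'X_(inord 4) ^+ e :> {mpoly k[5]}.
Proof.
rewrite mpolyXE_id !big_ord_recl big_ord0 mulr1 !mulrA !(mnm_nth 0%N) /=.
have e0 : ord0 = inord 0 :> 'I_5 by apply/val_inj; rewrite /= inordK.
have e1 : fintype.lift ord0 ord0 = inord 1 :> 'I_5 by apply/val_inj; rewrite /= inordK.
have e2 : fintype.lift ord0 (fintype.lift ord0 ord0) = inord 2 :> 'I_5 by apply/val_inj; rewrite /= inordK.
have e3 : fintype.lift ord0 (fintype.lift ord0 (fintype.lift ord0 ord0)) = inord 3 :> 'I_5.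
  by apply/val_inj; rewrite /= inordK.
have e4 : fintype.lift ord0 (fintype.lift ord0 (fintype.lift ord0 (fintype.lift ord0 ord0))) = inord 4 :> 'I_5.
  by apply/val_inj; rewrite /= inordK.
by rewrite e4 e3 e2 e1 e0.
Qed.

End Monomials.

Section ScrollRing.
Variable k : fieldType.
Local Notation R := {mpoly k[5]}.
Local Notation T := {mpoly k[4]}.
Local Notation x i := ('X_(inord i) : R).
Local Notation s := ('X_(inord 0) : T).
Local Notation t := ('X_(inord 1) : T).
Local Notation u := ('X_(inord 2) : T).
Local Notation v := ('X_(inord 3) : T).

Lemma eq_inord n i j : (i <= n)%N -> (j <= n)%N ->
  (inord i == inord j :> 'I_n.+1) = (i == j).
Proof. by move=> le_i le_j; rewrite -val_eqE /= !inordK. Qed.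

Lemma kill_inord n i j : (i <= n)%N -> (j <= n)%N ->
  kill_var (inord i) ('X_(inord j) : {mpoly k[n.+1]}) = if j == i then 0 else 'X_(inord j).
Proof. by move=> le_i le_j; rewrite kill_varX eq_inord. Qed.

Lemma kill_var0 n (i : 'I_n) : kill_var i (0 : {mpoly k[n]}) = 0.
Proof. exact: comp_mpoly0. Qed.

Definition killE := (kill_varB, kill_varD, kill_varM, kill_var_exp, kill_var0).

(* The quadric minor1 is prime: modulo it, every monomial is congruent to one
   without x0 x3, and those have distinct images under x1 -> x0 x1, x3 -> x1 x2. *)
Definition quadric_map : 5.-tuple R := [tuple x 0; x 0 * x 1; x 2; x 1 * x 2; x 4].

Definition quadric_exp (m : 'X_{1..5}) : 'X_{1..5} :=
  mn5 (m (inord 0) + m (inord 1)) (m (inord 1) + m (inord 3)) (m (inord 2) + m (inord 3)) 0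
      (m (inord 4)).

Definition quadric_std (m : 'X_{1..5}) : 'X_{1..5} :=
  let a := (m (inord 0) - m (inord 1))%N in
  mn5 a (m (inord 0) - a) (m (inord 2) - (m (inord 1) - (m (inord 0) - a)))
      (m (inord 1) - (m (inord 0) - a)) (m (inord 4)).

Lemma quadric_mapX m : 'X_[m] \mPo quadric_map = 'X_[quadric_exp m] :> R.
Proof.
have [a [b [c [d [e ->]]]]] := mn5_ex m.
rewrite /quadric_exp !mn5E !mpolyX_mn5 !rmorphM !rmorphXn /= !comp_mpolyXU !inordK //=.
by rewrite !exprMn !exprD expr0; ring.
Qed.

Lemma quadric_kernel (f : R) : f \mPo quadric_map = 0 ->
  exists z, f = z * minor1 (x 0) (x 1) (x 2) (x 3).
Proof.
set q := minor1 _ _ _ _; have idq := principal_ideal q.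
apply: (toric_kernel idq quadric_mapX (s := quadric_std)) => m.
have [a [b [c [d [e ->]]]]] := mn5_ex m.
(* Replacing x0 x3 by x1 x2 lowers the exponent of x0, until x0 or x3 is absent. *)
elim: a b c d => [|a IH] b c d.
  rewrite (_ : quadric_std _ = mn5 0 b c d e) ?subrr; first exact: ideal0.
  by rewrite /quadric_std /quadric_exp !mn5E; congr mn5; lia.
case: d => [|d].
  rewrite (_ : quadric_std _ = mn5 a.+1 b c 0 e) ?subrr; first exact: ideal0.
  by rewrite /quadric_std /quadric_exp !mn5E; congr mn5; lia.
have -> : quadric_exp (mn5 a.+1 b c d.+1 e) = quadric_exp (mn5 a b.+1 c.+1 d e).
  by rewrite /quadric_exp !mn5E; congr mn5; lia.
rewrite -[X in X - _](subrK ('X_[mn5 a b.+1 c.+1 d e])) -addrA.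
apply: idealD => //.
have -> : 'X_[mn5 a.+1 b c d.+1 e] - 'X_[mn5 a b.+1 c.+1 d e] = 'X_[mn5 a b c d e] * q.
  by rewrite !mpolyX_mn5 /q /minor1 !exprS; ring.
by exists 'X_[mn5 a b c d e].
Qed.

Lemma minor3_neq0 : minor3 (x 2) (x 3) (x 4) != 0.
Proof.
apply/eqP => /(congr1 (kill_var (inord 2))).
rewrite /minor3 !killE !kill_inord //= mul0r sub0r => /eqP.
by rewrite oppr_eq0 mulf_eq0 (negbTE (mpolyX_neq0 _ _)).
Qed.

(** Modulo x0 and x1 the relation reads c * minor3 = 0, so c lies in (x0, x1) and can be cancelled
    by rows of the Hilbert-Burch matrix. In the remaining relation between minor1 and minor2,
    primality of minor1 forces a multiple of the Koszul relation, which is x1 times the first row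
    minus x0 times the second. *)
Lemma scroll_minors_independent :
  minors_independent (x 0) (x 1) (x 2) (x 3) (x 4).
Proof.
move=> a b c e.
have [p [q ec]] : exists p q, c = p * x 0 + q * x 1.
  apply: kill_var2_eq0; have := congr1 (kill_var (inord 1)) (congr1 (kill_var (inord 0)) e).
  rewrite /minor1 /minor2 !killE !kill_inord //=.
  rewrite !kill_var0 !mul0r !subrr !mulr0 !add0r -expr2 -/(minor3 _ _ _).
  by move/eqP; rewrite mulf_eq0 (negbTE minor3_neq0) orbF => /eqP.
set a' := a - p * x 3 - q * x 4; set b' := b + p * x 2 + q * x 3.
have e' : a' * minor1 (x 0) (x 1) (x 2) (x 3) + b' * minor2 (x 0) (x 1) (x 3) (x 4) = 0.
  by rewrite -[RHS]e ec /a' /b' /minor1 /minor2 /minor3; ring.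
have [z ez] : exists z, b' = z * minor1 (x 0) (x 1) (x 2) (x 3).
  apply: quadric_kernel; have := congr1 (comp_mpoly quadric_map) e'.
  rewrite comp_mpoly0 comp_mpolyD !rmorphM /=.
  have -> : minor1 (x 0) (x 1) (x 2) (x 3) \mPo quadric_map = 0.
    rewrite /minor1 comp_mpolyB !rmorphM /= !comp_mpolyXU !inordK //=; ring.
  have -> : minor2 (x 0) (x 1) (x 3) (x 4) \mPo quadric_map =
      x 0 * (x 4 - x 1 ^+ 2 * x 2).
    rewrite /minor2 comp_mpolyB !rmorphM /= !comp_mpolyXU !inordK //=; ring.
  rewrite mulr0 add0r => /eqP; rewrite !mulf_eq0 (negbTE (mpolyX_neq0 _ _)) /=.
  case/orP => [/eqP //|/eqP/(congr1 (kill_var (inord 2)))].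
  rewrite !killE !kill_inord //= mulr0 subr0.
  by move/eqP; rewrite (negbTE (mpolyX_neq0 _ _)).
have ea : a' = - z * minor2 (x 0) (x 1) (x 3) (x 4).
  have nz : minor1 (x 0) (x 1) (x 2) (x 3) != 0.
    apply/eqP => /(congr1 (kill_var (inord 1))).
    rewrite /minor1 !killE !kill_inord //= mul0r subr0 => /eqP.
    by rewrite mulf_eq0 !(negbTE (mpolyX_neq0 _ _)).
  by apply: (mulIf nz); apply/eqP; rewrite -subr_eq0 -[X in _ == X]e' ez; apply/eqP; ring.
exists (p + z * x 1), (q - z * x 0); split.
- by have -> : a = a' + p * x 3 + q * x 4; [rewrite /a'; ring | rewrite ea /minor2; ring].
- by have -> : b = b' - p * x 2 - q * x 3; [rewrite /b'; ring | rewrite ez /minor1; ring].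
by rewrite ec; ring.
Qed.

End ScrollRing.

(** * The Cox ring of the scroll and its divisors *)

Section CoxRing.
Variable k : fieldType.
Local Notation R := {mpoly k[5]}.
Local Notation T := {mpoly k[4]}.
Local Notation x i := ('X_(inord i) : R).
Local Notation s := ('X_(inord 0) : T).
Local Notation t := ('X_(inord 1) : T).
Local Notation u := ('X_(inord 2) : T).
Local Notation v := ('X_(inord 3) : T).

Definition to_cox (f : R) : T := f \mPo scroll_map s t u v.
Local Notation phi := to_cox.

Lemma to_coxM f g : phi (f * g) = phi f * phi g. Proof. exact: rmorphM. Qed.
Lemma to_coxD f g : phi (f + g) = phi f + phi g. Proof. exact: comp_mpolyD. Qed.
Lemma to_coxB f g : phi (f - g) = phi f - phi g. Proof. exact: comp_mpolyB. Qed.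
Lemma to_cox0 : phi 0 = 0. Proof. exact: comp_mpoly0. Qed.
Lemma to_coxXn f d : phi (f ^+ d) = phi f ^+ d. Proof. exact: rmorphXn. Qed.
Lemma to_coxZ c f : phi (c *: f) = c *: phi f. Proof. exact: comp_mpolyZ. Qed.

Lemma to_cox_var : ((phi (x 0) = (s * u)%R) * (phi (x 1) = (t * u)%R) *
  (phi (x 2) = (s ^+ 2 * v)%R) * (phi (x 3) = (s * t * v)%R) *
  (phi (x 4) = (t ^+ 2 * v)%R))%type.
Proof. by rewrite /to_cox !comp_mpolyXU !inordK. Qed.

Definition cox_exp (m : 'X_{1..5}) : 'X_{1..4} :=
  mn4 (m (inord 0) + 2 * m (inord 2) + m (inord 3))
      (m (inord 1) + m (inord 3) + 2 * m (inord 4))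
      (m (inord 0) + m (inord 1)) (m (inord 2) + m (inord 3) + m (inord 4)).

(* The preimage of a monomial of weight 0 not divisible by x0 x3, x0 x4, x2 x4. *)
Definition cox_std (m : 'X_{1..4}) : 'X_{1..5} :=
  let q := m (inord 1) in let i := m (inord 2) in let j := m (inord 3) in
  let r := (q - i)%N in
  mn5 (i - q) (minn q i) (j - r) (j - (j - r) - (r - j)) (r - j).

Lemma to_coxX m : phi 'X_[m] = 'X_[cox_exp m].
Proof.
have [a [b [c [d [e ->]]]]] := mn5_ex m.
rewrite /cox_exp !mn5E mpolyX_mn5 mpolyX_mn4 !to_coxM !to_coxXn !to_cox_var.
by rewrite !exprMn !exprD !expr0; ring.
Qed.

Definition minor_ideal (f : R) : Prop := exists a b c,
  f = a * minor1 (x 0) (x 1) (x 2) (x 3) + b * minor2 (x 0) (x 1) (x 3) (x 4)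
    + c * minor3 (x 2) (x 3) (x 4).

Lemma minor_idealP : is_ideal minor_ideal.
Proof.
split; first by exists 0, 0, 0; rewrite !mul0r !addr0.
  by move=> _ _ [a [b [c ->]]] [a' [b' [c' ->]]]; exists (a + a'), (b + b'), (c + c'); ring.
by move=> g _ [a [b [c ->]]]; exists (g * a), (g * b), (g * c); ring.
Qed.

Lemma cox_std_congr a b c d e :
  minor_ideal ('X_[mn5 a b c d e] - 'X_[cox_std (cox_exp (mn5 a b c d e))]).
Proof.
have idI := minor_idealP.
have step m m' : cox_exp m = cox_exp m' -> minor_ideal ('X_[m] - 'X_[m']) ->
    minor_ideal ('X_[m'] - 'X_[cox_std (cox_exp m')]) ->
    minor_ideal ('X_[m] - 'X_[cox_std (cox_exp m)]).
  move=> em mm' m's; rewrite em -[X in X - _](subrK 'X_[m']) -addrA.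
  exact: idealD.
(* The weights are the squares of the indices. By convexity each rewriting x0 x3 -> x1 x2, x0 x4 ->
   x1 x3, x2 x4 -> x3^2 lowers the total: 9 to 5, 16 to 10, 20 to 18. *)
have [n] := ubnP (b + 4 * c + 9 * d + 16 * e)%N.
elim: n a b c d e => // n IH a b c d e; rewrite ltnS => le_n.
case: a => [|a] in le_n *; last first.
  case: d => [|d] in le_n *; last first.
    apply: (step _ (mn5 a b.+1 c.+1 d e)) => //.
    - by rewrite /cox_exp !mn5E; congr mn4; lia.
    - exists 'X_[mn5 a b c d e], 0, 0; rewrite !mpolyX_mn5 /minor1 !exprS; ring.
    - by apply: IH; lia.
  case: e => [|e] in le_n *; last first.
    apply: (step _ (mn5 a b.+1 c 1 e)) => //.
    - by rewrite /cox_exp !mn5E; congr mn4; lia.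
    - exists 0, 'X_[mn5 a b c 0 e], 0; rewrite !mpolyX_mn5 /minor2 !exprS !expr0; ring.
    - by apply: IH; lia.
  rewrite (_ : cox_std _ = mn5 a.+1 b c 0 0) ?subrr; first exact: ideal0.
  by rewrite /cox_std /cox_exp !mn5E !mn4E; congr mn5; lia.
case: c => [|c] in le_n *.
  rewrite (_ : cox_std _ = mn5 0 b 0 d e) ?subrr; first exact: ideal0.
  by rewrite /cox_std /cox_exp !mn5E !mn4E; congr mn5; lia.
case: e => [|e] in le_n *; last first.
  apply: (step _ (mn5 0 b c d.+2 e)) => //.
  - by rewrite /cox_exp !mn5E; congr mn4; lia.
  - exists 0, 0, 'X_[mn5 0 b c d e]; rewrite !mpolyX_mn5 /minor3 !exprS; ring.
  - by apply: IH; lia.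
rewrite (_ : cox_std _ = mn5 0 b c.+1 d 0) ?subrr; first exact: ideal0.
by rewrite /cox_std /cox_exp !mn5E !mn4E; congr mn5; lia.
Qed.

Lemma scroll_idealP f : scroll_ideal f <-> minor_ideal f.
Proof.
split=> [f0|[a [b [c ->]]]].
  apply: (toric_kernel minor_idealP to_coxX (s := cox_std) _ f0) => m.
  by have [a [b [c [d [e ->]]]]] := mn5_ex m; apply: cox_std_congr.
rewrite /scroll_ideal -/(phi _) /minor1 /minor2 /minor3.
by rewrite !(to_coxB, to_coxD, to_coxM, to_coxXn) !to_cox_var; ring.
Qed.

Lemma to_cox_eq0 f : phi f = 0 -> scroll_ideal f. Proof. by []. Qed.

(* A monomial of class a H + b F has [Hwt] a and [Fwt] b. *)
Definition Hwt (m : 'X_{1..4}) : int := (m (inord 2) + m (inord 3))%:Z.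
Definition Fwt (m : 'X_{1..4}) : int :=
  (m (inord 0) + m (inord 1))%:Z - (m (inord 2) + 2 * m (inord 3))%:Z.

Lemma HwtD m m' : Hwt (m + m')%MM = Hwt m + Hwt m'.
Proof. by rewrite /Hwt !mnmDE; lia. Qed.
Lemma FwtD m m' : Fwt (m + m')%MM = Fwt m + Fwt m'.
Proof. by rewrite /Fwt !mnmDE; lia. Qed.

Lemma cox_expK m : Fwt m = 0 -> cox_exp (cox_std m) = m.
Proof.
have [p [q [i [j ->]]]] := mn4_ex m.
by rewrite /Fwt /cox_exp /cox_std !mn5E !mn4E => e; congr mn4; lia.
Qed.

Lemma mdeg_cox_std m : Fwt m = 0 -> (mdeg (cox_std m))%:Z = Hwt m.
Proof.
have [p [q [i [j ->]]]] := mn4_ex m.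
rewrite /Fwt /Hwt /cox_std mdeg_mn5 !mn4E => e; lia.
Qed.

(** The image of phi is the F-weight 0 part of T, since [cox_std] lifts each monomial of that
    weight, with the H-weight as degree. This is how elements of R are produced from expressions in
    T. *)
Lemma to_cox_surj g : weight_homog Fwt 0 g ->
  exists2 f, phi f = g & forall d : nat, weight_homog Hwt d%:Z g -> f \is d.-homog.
Proof.
move=> hg; apply: (mpoly_supp_ind (p := g) (Q := fun h => exists2 f, phi f = h &
    forall d : nat, weight_homog Hwt d%:Z g -> f \is d.-homog)).
- by exists 0 => [|d _]; [apply: to_cox0 | apply: rpred0].
- move=> _ _ [f1 <- h1] [f2 <- h2]; exists (f1 + f2) => [|d hd]; first exact: to_coxD.
  by apply: rpredD; [apply: h1 | apply: h2].
move=> m mg; exists (g@_m *: 'X_[cox_std m]) => [|d hd].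
  by rewrite to_coxZ to_coxX cox_expK //; apply: hg.
apply: rpredZ; rewrite dhomogX; apply/eqP.
by have := mdeg_cox_std (hg _ mg); rewrite (hd _ mg) => -[].
Qed.

Lemma to_cox_Fwt f : weight_homog Fwt 0 (phi f).
Proof.
rewrite /to_cox comp_mpolyEX => m /msupp_sum_le /flattenP[r /mapP[m' _ ->]].
move/msuppZ_le; rewrite -/(phi _) to_coxX => /mem_msuppXP <-.
have [a [b [c [d [e ->]]]]] := mn5_ex m'.
by rewrite /cox_exp /Fwt !mn5E !mn4E; lia.
Qed.

Lemma to_cox_Hwt (d : nat) f : f \is d.-homog -> weight_homog Hwt d%:Z (phi f).
Proof.
move=> /dhomogP hf; rewrite /to_cox comp_mpolyEX => m /msupp_sum_le /flattenP[r /mapP[m']].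
rewrite mem_filter => /andP[_ /hf em'] -> /msuppZ_le.
rewrite -/(phi _) to_coxX => /mem_msuppXP <-; have : mdeg m' = d := em'.
have [a [b [c [d' [e ->]]]]] := mn5_ex m'.
by rewrite mdeg_mn5 /cox_exp /Hwt !mn5E !mn4E; lia.
Qed.

Lemma Fwt_var : ((weight_homog Fwt 1%R s) * (weight_homog Fwt 1%R t) *
  (weight_homog Fwt (-1)%R u) * (weight_homog Fwt (-2)%R v))%type.
Proof.
do !split; apply: weight_homogX;
  by rewrite /Fwt !mnm1E !eq_inord.
Qed.

Lemma Hwt_var : ((weight_homog Hwt 0%R s) * (weight_homog Hwt 0%R t) *
  (weight_homog Hwt 1%R u) * (weight_homog Hwt 1%R v))%type.
Proof.
do !split; apply: weight_homogX;
  by rewrite /Hwt !mnm1E !eq_inord.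
Qed.

Lemma to_cox_var_factor i : exists l y : T,
  [/\ phi 'X_i = l * y, weight_homog Fwt 1 l & weight_homog Fwt (-1) y].
Proof.
have [[[[e0 e1] e2] e3] e4] := to_cox_var; have [[[ws wt] wu] wv] := Fwt_var.
have wsv : weight_homog Fwt (-1) (s * v) := weight_homogM FwtD ws wv.
have wtv : weight_homog Fwt (-1) (t * v) := weight_homogM FwtD wt wv.
rewrite -(inord_val i); case: i => -[|[|[|[|[|]]]]] //= _.
- by exists s, u.
- by exists t, u.
- by exists s, (s * v); split=> //; rewrite e2; ring.
- by exists s, (t * v); split=> //; rewrite e3; ring.
- by exists t, (t * v); split=> //; rewrite e4; ring.
Qed.

Definition cox_ideal (A : T) (f : R) : Prop := exists C, phi f = A * C.

Lemma cox_idealP A : is_ideal (cox_ideal A).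
Proof.
split; first by exists 0; rewrite to_cox0 mulr0.
  by move=> f g [C eC] [D eD]; exists (C + D); rewrite to_coxD eC eD; ring.
by move=> f g [C eC]; exists (phi f * C); rewrite to_coxM eC; ring.
Qed.

Lemma scroll_sub_cox_ideal A f : scroll_ideal f -> cox_ideal A f.
Proof. by move=> f0; exists 0; rewrite mulr0; apply: f0. Qed.

Lemma scroll_ideal_is_ideal : is_ideal (@scroll_ideal k).
Proof.
have [h0 hD hM] := minor_idealP; split; first by apply/scroll_idealP.
  by move=> f g /scroll_idealP hf /scroll_idealP hg; apply/scroll_idealP/hD.
by move=> f g /scroll_idealP hg; apply/scroll_idealP/hM.
Qed.

(* s^a u^b and t^c v^d are coprime. *)
Lemma coprime_dvd (P F : T) a b c d : P != 0 ->
  (exists C, F * (s ^+ a * u ^+ b) = P * C) ->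
  (exists C, F * (t ^+ c * v ^+ d) = P * C) -> exists C, F = P * C.
Proof.
move=> nzP [B1 e1] [B2 e2].
have nX i : 'X_i != 0 :> T by apply: mpolyX_neq0.
(* Eliminating F leaves an identity in which s^a and then u^b can be stripped off B1, neither s nor
   u dividing t^c v^d. *)
have e : B1 * (t ^+ c * v ^+ d) = s ^+ a * (u ^+ b * B2).
  apply: (mulfI nzP); rewrite [LHS]mulrA -e1 [LHS]mulrAC e2; ring.
have nzk i : i = 0%N \/ i = 2 -> kill_var (inord i) (t ^+ c * v ^+ d) != 0.
  by case=> ->; rewrite !killE !kill_inord //= mulf_neq0 ?expf_neq0.
have [C1 eC1] := var_pow_dvd (nzk _ (or_introl erefl)) e.
have e' : C1 * (t ^+ c * v ^+ d) = u ^+ b * B2.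
  by apply: (mulfI (expf_neq0 a (nX (inord 0)))); rewrite [LHS]mulrA -eC1 e.
have [C2 eC2] := var_pow_dvd (nzk _ (or_intror erefl)) e'.
exists C2; apply: (mulIf (mulf_neq0 (expf_neq0 a (nX (inord 0))) (expf_neq0 b (nX (inord 2))))).
by rewrite e1 eC1 eC2; ring.
Qed.

Lemma to_cox_var_pow n : (phi (x 0 ^+ n) = s ^+ n * u ^+ n) /\
  (phi (x 4 ^+ n) = t ^+ (n + n) * v ^+ n).
Proof. by rewrite !to_coxXn !to_cox_var !exprMn exprD. Qed.

(** Powers of x0 and x4 suffice: they pull back to s^N u^N and t^(2N) v^N, which are coprime. *)
Lemma sat_cox_ideal A f : A != 0 -> sat (cox_ideal A) f -> cox_ideal A f.
Proof.
move=> nzA [N hN]; have [e0 e4] := to_cox_var_pow N.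
have pow i : cox_ideal A ('X_i ^+ N * f).
  by rewrite mpolyXn; apply: hN; rewrite mdegMn mdeg1 mul1n.
apply: (coprime_dvd (a := N) (b := N) (c := N + N) (d := N) nzA).
  by have [C eC] := pow (inord 0); exists C; rewrite -eC to_coxM e0 mulrC.
by have [C eC] := pow (inord 4); exists C; rewrite -eC to_coxM e4 mulrC.
Qed.

Lemma sat_sub (I J : R -> Prop) f : (forall g, I g -> J g) -> sat I f -> sat J f.
Proof. by move=> sIJ [N hN]; exists N => m /hN /sIJ. Qed.

Lemma sub_sat (I : R -> Prop) f : I f -> sat I f.
Proof.
move=> If; exists 0%N => m /eqP; rewrite mdeg_eq0 => /eqP ->.
by rewrite mpolyX0 mul1r.
Qed.

Lemma cofactor_Fwt (A C : T) b f : A != 0 -> weight_homog Fwt b A ->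
  phi f = A * C -> weight_homog Fwt (- b) C.
Proof.
move=> nzA hA e; apply: (weight_homog_quotient FwtD nzA hA).
by rewrite subrr -e; apply: to_cox_Fwt.
Qed.

(* Multiplication by a high power of a variable x = l y, with l of class F and
   y of class H - F, splits a section of D + E into sections of D and of E. *)
Lemma div_add_cox (D E : R -> Prop) (A B : T) (b1 : nat) (b2 : int) :
  A != 0 -> B != 0 -> weight_homog Fwt b1%:Z A -> weight_homog Fwt b2 B ->
  (forall f, D f <-> cox_ideal A f) -> (forall f, E f <-> cox_ideal B f) ->
  forall f, div_add D E f <-> cox_ideal (A * B) f.
Proof.
move=> nzA nzB hA hB eD eE f; have nzAB := mulf_neq0 nzA nzB.
have idAB := cox_idealP (A * B).
split=> [Df|[C eC]].
  apply: (sat_cox_ideal nzAB); apply: sat_sub Df => _ [g [h [Dg Sh ->]]].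
  apply: idealD => //; last exact: scroll_sub_cox_ideal.
  case: Dg => m [c [g' [hg' ->]]]; apply: ideal_sum => // i _.
  have [g1 [g2 [/eD[C1 e1] /eE[C2 e2] ->]]] := hg' i; apply: idealM => //.
  by exists (C1 * C2); rewrite to_coxM e1 e2; ring.
have hC : weight_homog Fwt (- (b1%:Z + b2)) C.
  exact: cofactor_Fwt nzAB (weight_homogM FwtD hA hB) eC.
(* A monomial of degree 5 b1 in five variables contains some variable to the power b1. *)
exists (5 * b1)%N => m dm.
have [i lei] : exists i, (b1 <= m i)%N.
  have [a [b [c [d [e em]]]]] := mn5_ex m; move: dm; rewrite em mdeg_mn5 => dm.
  suff : (b1 <= a \/ b1 <= b \/ b1 <= c \/ b1 <= d \/ b1 <= e)%N.
    by case=> [h|[h|[h|[h|h]]]]; [exists (inord 0) | exists (inord 1) | exists (inord 2)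
      | exists (inord 3) | exists (inord 4)]; rewrite mn5E.
  by lia.
have [l [y [ely hl hy]]] := to_cox_var_factor i.
pose m' := (m - U_(i) *+ b1)%MM.
have em : 'X_[m] = 'X_i ^+ b1 * 'X_[m'] :> R.
  rewrite mpolyXn -mpolyXD addmC submK //; apply/mnm_lepP => j.
  by rewrite mulmnE mnm1E; case: eqP => [<-|_]; rewrite ?mul1n ?mul0n.
(* A y^b1 has F-weight b1 - b1 = 0, and moving l^b1 to the other factor balances the weight of B C
   as well, so both factors lift to R. *)
have [g1 eg1 _] : exists2 g1, phi g1 = A * y ^+ b1 & forall d : nat,
    weight_homog Hwt d%:Z (A * y ^+ b1) -> g1 \is d.-homog.
  apply: to_cox_surj; have := weight_homogM FwtD hA (weight_homog_exp (d := b1) FwtD hy).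
  by rewrite mulNrn -natz subrr.
have [g2 eg2 _] : exists2 g2, phi g2 = B * (l ^+ b1 * (C * phi 'X_[m'])) & forall d : nat,
    weight_homog Hwt d%:Z (B * (l ^+ b1 * (C * phi 'X_[m']))) -> g2 \is d.-homog.
  apply: to_cox_surj.
  have := weight_homogM FwtD hB (weight_homogM FwtD (weight_homog_exp (d := b1) FwtD hl)
    (weight_homogM FwtD hC (to_cox_Fwt (f := 'X_[m'])))).
  by rewrite (_ : b2 + _ = 0) //; rewrite -natz; ring.
exists (g1 * g2), ('X_[m] * f - g1 * g2); split; last by rewrite addrC subrK.
  exists 1%N, (fun _ => 1), (fun _ => g1 * g2); split; last by rewrite big_ord1 mul1r.
  move=> _; exists g1, g2; split=> //; first by apply/eD; exists (y ^+ b1).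
  by apply/eE; eexists; apply: eg2.
apply: to_cox_eq0; rewrite to_coxB !to_coxM em to_coxM to_coxXn ely eg1 eg2 eC exprMn.
by ring.
Qed.

(** Since phi p has F-weight 0, so has the cofactor, which therefore lifts to R directly. *)
Lemma div_form_cox p : ~ scroll_ideal p ->
  forall f, div_form p f <-> cox_ideal (phi p) f.
Proof.
move=> nzp f; have nz : phi p != 0 by apply/eqP => /to_cox_eq0.
split=> [pf|[C eC]].
  apply: (sat_cox_ideal nz); apply: sat_sub pf => _ [_ [h [[c ->] Sh ->]]].
  apply: idealD; [exact: cox_idealP | | exact: scroll_sub_cox_ideal].
  by exists (phi c); rewrite to_coxM mulrC.
have := cofactor_Fwt nz (to_cox_Fwt (f := p)) eC; rewrite oppr0 => /to_cox_surj[c ec _].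
apply: sub_sat; exists (c * p), (f - c * p); split; last by rewrite addrC subrK.
  by exists c.
by apply: to_cox_eq0; rewrite to_coxB to_coxM eC ec; ring.
Qed.

(** The torus action restores the coordinate t that the parametrization of [ruling_line] sets to
    1. *)
Lemma scroll_map_scale (A : comNzRingType) (t' u' v' : A) :
  scroll_map 0 1 (t' * u') (t' ^+ 2 * v') = scroll_map 0 t' u' v'.
Proof.
by apply/val_inj; rewrite /= !expr0n !mul0r expr1n !mul1r.
Qed.

Lemma ruling_line_cox f : ruling_line f <-> cox_ideal s f.
Proof.
have kill_phi : kill_var (inord 0) (phi f) = f \mPo scroll_map 0 t u v.
  rewrite /kill_var /to_cox comp_scroll_map -!/(kill_var _ _).
  by rewrite !kill_inord.
split=> [f0|[C eC]].
  have /kill_var_eq0[C eC] : kill_var (inord 0) (phi f) = 0.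
    pose lr := [tuple t * u; t ^+ 2 * v].
    have e0 : ('X_(inord 0) : {mpoly k[2]}) \mPo lr = t * u by rewrite comp_mpolyXU inordK.
    have e1 : ('X_(inord 1) : {mpoly k[2]}) \mPo lr = t ^+ 2 * v.
      by rewrite comp_mpolyXU inordK.
    have := comp_scroll_map f 0 1 'X_(inord 0) 'X_(inord 1) lr.
    rewrite e0 e1 comp_mpoly0 comp_mpoly1 scroll_map_scale kill_phi => <-.
    by have -> : f \mPo scroll_map 0 1 'X_(inord 0) 'X_(inord 1) = 0 := f0; apply: comp_mpoly0.
  by exists C; rewrite eC mulrC.
have e : f \mPo scroll_map 0 t u v = 0.
  by rewrite -kill_phi eC killE kill_inord //= mul0r.
pose lr := [tuple 0; 1; 'X_(inord 0); 'X_(inord 1) : {mpoly k[2]}].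
have e1 : t \mPo lr = 1 by rewrite comp_mpolyXU inordK.
have e2 : u \mPo lr = 'X_(inord 0) by rewrite comp_mpolyXU inordK.
have e3 : v \mPo lr = 'X_(inord 1) by rewrite comp_mpolyXU inordK.
have := comp_scroll_map f 0 t u v lr; rewrite e e1 e2 e3 !comp_mpoly0 => e'.
exact: esym e'.
Qed.

Lemma div_muln_cox (D : R -> Prop) (A : T) (b n : nat) : A != 0 ->
  weight_homog Fwt b%:Z A -> (forall f, D f <-> cox_ideal A f) ->
  forall f, div_muln n D f <-> cox_ideal (A ^+ n) f.
Proof.
move=> nzA hA eD; elim: n => [|n IH] f.
  by split=> // _; exists (phi f); rewrite mul1r.
rewrite exprS; apply: (div_add_cox nzA (expf_neq0 n nzA) hA) => //.
exact: (weight_homog_exp (d := n) FwtD hA).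
Qed.

(** The hyperplane section x0 = 0 pulls back to s u, and the chosen ruling line is s = 0. *)
Definition class_eq a b : T := (s * u) ^+ a * s ^+ b.

Lemma class_eq_neq0 a b : class_eq a b != 0.
Proof. by rewrite !(mulf_neq0, expf_neq0, mpolyX_neq0). Qed.

Lemma class_eq_Fwt a b : weight_homog Fwt b%:Z (class_eq a b).
Proof.
have [[[ws _] wu] _] := Fwt_var.
have := weight_homogM FwtD (weight_homog_exp (d := a) FwtD (weight_homogM FwtD ws wu))
  (weight_homog_exp (d := b) FwtD ws).
by rewrite addrN mul0rn add0r -natz.
Qed.

Lemma class_eq_Hwt a b : weight_homog Hwt a%:Z (class_eq a b).
Proof.
have [[[ws _] wu] _] := Hwt_var.
have := weight_homogM HwtD (weight_homog_exp (d := a) HwtD (weight_homogM HwtD ws wu))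
  (weight_homog_exp (d := b) HwtD ws).
by rewrite add0r mul0rn addr0 -natz.
Qed.

Lemma div_aH_bF_cox a b f : div_aH_bF a b f <-> cox_ideal (class_eq a b) f.
Proof.
have [[[ws _] wu] _] := Fwt_var.
have nzs : s != 0 by apply: mpolyX_neq0.
have nzsu : s * u != 0 by rewrite mulf_neq0 ?mpolyX_neq0.
have wsu : weight_homog Fwt 0%:Z (s * u) := weight_homogM FwtD ws wu.
have hyp g : hyperplane_section g <-> cox_ideal (s * u) g.
  have := @div_form_cox (x 0); rewrite !to_cox_var; apply => /eqP.
  by rewrite -/(phi _) to_cox_var (negbTE nzsu).
apply: (@div_add_cox _ _ _ _ 0 b%:Z); rewrite ?expf_neq0 //.
- by have := weight_homog_exp (d := a) FwtD wsu; rewrite mul0rn.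
- by have := weight_homog_exp (d := b) FwtD ws; rewrite -natz.
- exact: div_muln_cox nzsu wsu hyp.
exact: (@div_muln_cox _ _ 1 b nzs ws ruling_line_cox).
Qed.

(* If X + div p = (a H + b F) + div q, then the equation of a H + b F times that
   of q is divisible by that of p, and the quotient is an equation of X. *)
Lemma effective_divisor_equation a b (X : R -> Prop) :
  effective_divisor X -> lin_equiv X (div_aH_bF a b) ->
  exists G : T, [/\ G != 0, weight_homog Hwt a%:Z G, weight_homog Fwt b%:Z G &
                    forall f, X f <-> cox_ideal G f].
Proof.
move=> [[idX _ satX] SX _] [d [p [q [hp hq nzp nzq eXq]]]].
have nzP : phi p != 0 by apply/eqP => /to_cox_eq0.
have nzQ : phi q != 0 by apply/eqP => /to_cox_eq0.
set A := class_eq a b * phi q.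
have nzA : A != 0 by rewrite mulf_neq0 ?class_eq_neq0.
have eXA f : div_add X (div_form p) f <-> cox_ideal A f.
  rewrite eXq; apply: (div_add_cox (class_eq_neq0 a b) nzQ (class_eq_Fwt (a := a) (b := b)) (to_cox_Fwt (f := q))).
    exact: div_aH_bF_cox.
  exact: div_form_cox.
have hA : weight_homog Fwt b%:Z A.
  by have := weight_homogM FwtD (class_eq_Fwt (a := a) (b := b)) (to_cox_Fwt (f := q)); rewrite addr0.
have dvd_cox f : div_add X (div_form p) f -> cox_ideal (phi p) f.
  move=> Df; apply: (sat_cox_ideal nzP); apply: sat_sub Df => _ [g [h [Dg Sh ->]]].
  have idP := cox_idealP (phi p); apply: idealD => //; last exact: scroll_sub_cox_ideal.
  case: Dg => m [c [g' [hg' ->]]]; apply: ideal_sum => // i _.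
  have [g1 [g2 [_ /(div_form_cox nzp) h2 ->]]] := hg' i.
  by do !apply: idealM => //.
(* A y has F-weight 0, so it is the pullback of some f in R; this f belongs to the sum of X and div
   p. *)
have dvd y : weight_homog Fwt (- b%:Z) y -> exists C, A * y = phi p * C.
  move=> hy; have := weight_homogM FwtD hA hy; rewrite subrr => /to_cox_surj[f ef _].
  by rewrite -ef; apply/dvd_cox/eXA; exists y.
have [[[ws wt] wu] wv] := Fwt_var.
have [G eG] : exists G, A = phi p * G.
  (* The coprime multipliers are u^b and t^b v^b, both of F-weight -b. *)
  apply: (coprime_dvd (a := 0) (b := b) (c := b) (d := b) nzP); apply: dvd.
    rewrite expr0 mul1r; have := weight_homog_exp (d := b) FwtD wu.
    by rewrite mulNrn -natz.
  have := weight_homogM FwtD (weight_homog_exp (d := b) FwtD wt) (weight_homog_exp (d := b) FwtD wv).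
  by rewrite -mulrnDl (_ : 1 + -2 = -1) // mulNrn -natz.
have nzG : G != 0 by apply: contraNneq nzA => G0; rewrite eG G0 mulr0.
exists G; split=> //.
- apply: (weight_homog_quotient HwtD nzP (to_cox_Hwt hp)); rewrite -eG.
  by rewrite addrC; apply: (weight_homogM HwtD (@class_eq_Hwt a b) (to_cox_Hwt hq)).
- by apply: (weight_homog_quotient FwtD nzP (to_cox_Fwt (f := p))); rewrite -eG add0r.
move=> f; split=> [Xf|[C eC]].
  have [C eC] : cox_ideal A (p * f).
    apply/eXA/sub_sat; exists (p * f), 0; rewrite addr0; split=> //.
      exists 1%N, (fun _ => 1), (fun _ => p * f); split; last by rewrite big_ord1 mul1r.
      move=> _; exists f, p; split=> //; last by rewrite mulrC.
      by apply/(div_form_cox nzp); exists 1; rewrite mulr1.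
    by apply: ideal0; apply: scroll_ideal_is_ideal.
  by exists C; apply: (mulfI nzP); rewrite -to_coxM eC eG mulrA.
have : div_add X (div_form p) (p * f).
  by apply/eXA; exists C; rewrite to_coxM eC eG mulrA.
move=> [N hN]; apply: satX; exists N => m /hN [_ [h [[l [c [g [hg ->]]]] Sh e]]].
(* Modulo I(S) every element of the product of the ideals of X and div p is w p with w in X.
   Cancelling phi p then shows that the monomial multiple of f agrees with w modulo I(S). *)
have [w [Xw Sw]] : exists w, X w /\ scroll_ideal (\sum_(i < l) c i * g i - w * p).
  apply: (big_ind (fun z => exists w, X w /\ scroll_ideal (z - w * p))).
  - by exists 0; rewrite mul0r subr0; split; [apply: ideal0 | apply: (ideal0 scroll_ideal_is_ideal)].
  - move=> z1 z2 [w1 [X1 S1]] [w2 [X2 S2]]; exists (w1 + w2); split; first exact: idealD.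
    by rewrite mulrDl opprD addrACA; apply: (idealD scroll_ideal_is_ideal).
  move=> i _; have [g1 [g2 [X1 /(div_form_cox nzp)[D eD] ->]]] := hg i.
  have := cofactor_Fwt nzP (to_cox_Fwt (f := p)) eD; rewrite oppr0 => /to_cox_surj[h' eh' _].
  exists (c i * h' * g1); split; first exact: idealM.
  by apply: to_cox_eq0; rewrite to_coxB !to_coxM eD eh'; ring.
rewrite -['X_[m] * f](subrK w); apply: idealD => //; apply: SX.
apply: to_cox_eq0; apply: (mulIf nzP); rewrite mul0r -to_coxM.
have -> : ('X_[m] * f - w) * p = (\sum_(i < l) c i * g i - w * p) + h.
  by rewrite mulrBl -addrA [- _ + h]addrC addrA -e; ring.
by rewrite to_coxD [phi h]Sh addr0; apply: Sw.
Qed.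

End CoxRing.

(** * Resolutions of the ideals of divisors *)

Section Resolutions.
Variable k : fieldType.
Local Notation R := {mpoly k[5]}.
Local Notation T := {mpoly k[4]}.
Local Notation x i := ('X_(inord i) : R).
Local Notation s := ('X_(inord 0) : T).
Local Notation t := ('X_(inord 1) : T).
Local Notation u := ('X_(inord 2) : T).
Local Notation v := ('X_(inord 3) : T).
Local Notation phi := (@to_cox k).

Lemma graded_const m n c d0 d1 (A : 'M[R]_(m, n)) : d1 = (c + d0)%N ->
  (forall i j, A i j \is c.-homog) -> graded_mx (fun _ => d1) (fun _ => d0) A.
Proof. by move=> -> hA i j e eA; have /dhomogP/(_ _ eA) <- := hA i j. Qed.

Lemma dhomog_var i : x i \is 1%N.-homog.
Proof. by rewrite dhomogX; apply/eqP/mdeg1. Qed.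

Lemma dhomog_seqmx m n (l : seq (seq R)) d :
  all (all (fun p : R => p \is d.-homog)) l -> forall i j, seqmx m n l i j \is d.-homog.
Proof.
move=> hl i j; rewrite mxE.
have [lti|gei] := ltnP i (size l); last by rewrite (nth_default [::] gei) nth_nil rpred0.
have := allP hl _ (mem_nth [::] lti) => hr.
have [ltj|gej] := ltnP j (size (nth [::] l i)); last by rewrite nth_default // rpred0.
exact: (allP hr _ (mem_nth 0 ltj)).
Qed.

Lemma dhomog_minors : [/\ minor1 (x 0) (x 1) (x 2) (x 3) \is 2%N.-homog,
  minor2 (x 0) (x 1) (x 3) (x 4) \is 2%N.-homog & minor3 (x 2) (x 3) (x 4) \is 2%N.-homog].
Proof.
have h i j : x i * x j \is 2%N.-homog by apply: (dhomogM (dhomog_var i) (dhomog_var j)).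
by split; rewrite /minor1 /minor2 /minor3 ?expr2; apply: rpredB; apply: h.
Qed.

Let xN0 i : x i != 0 := mpolyX_neq0 k _.

Lemma mx11P (A B : 'M[R]_(1, 1)) : A = B <-> A 0 0 = B 0 0.
Proof.
by split=> [->|e] //; apply/matrixP => i j; rewrite (ord1 i) (ord1 j).
Qed.

Lemma minor_idealE f : minor_ideal f <->
  exists h : 'rV_3, f = (h *m minors_mx (x 0) (x 1) (x 2) (x 3) (x 4)) 0 0.
Proof.
split=> [[a [b [c ->]]]|[h ->]].
  by exists (rowl 3 [:: a; b; c]); rewrite !mxE !big_ord_recl big_ord0 !mxE /= addr0 addrA.
have [l sl ->] := rowl_ex h; case: l sl => [|a [|b [|c [|? ?]]]] // _.
by exists a, b, c; rewrite !mxE !big_ord_recl big_ord0 !mxE /= addr0 addrA.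
Qed.

Local Notation minors := (minors_mx (x 0) (x 1) (x 2) (x 3) (x 4)).
Local Notation hb := (hilbert_burch_mx (x 0) (x 1) (x 2) (x 3) (x 4)).

Lemma hb_graded d : graded_mx (fun _ => d.+1) (fun _ => d) hb.
Proof.
apply: (graded_const (c := 1%N)) => //; apply: dhomog_seqmx => /=.
by rewrite !rpredN !dhomog_var.
Qed.

Lemma minors_graded d : graded_mx (fun _ => d.+2) (fun _ => d) minors.
Proof.
apply: (graded_const (c := 2%N)) => //; apply: dhomog_seqmx => /=.
by have [-> -> ->] := dhomog_minors.
Qed.

(** [row_at] reindexed by the total degree e = i + j, in which generators of a resolution are
    counted. *)
Definition row_total (l : nat) (r : seq nat) (i e : nat) : nat :=
  if (l + i)%N == e then nth 0%N r i else 0%N.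

Lemma scroll_ideal_resolution :
  has_minimal_resolution (@scroll_ideal k) (row_total 2 [:: 3; 2; 0; 0]%N).
Proof.
pose e i := (2 + i)%N.
exists (@pure_cpx k 5 3 2 0 0 e hb 0 0 minors).
have g0 := @minors_graded 0; have g1 := @hb_graded 2.
have gz m n dr dc : @graded_mx k 5 m n dr dc 0 := graded_mx0 dr dc.
have es i : (e i < e i.+1)%N by rewrite /e addnS.
split=> [||i d]; last by rewrite card_pure.
  apply: relative_resolution0; apply: pure_relative_resolution => //.
  - move=> f; split=> [/scroll_idealP/minor_idealE[h ->]|[j [w [-> ->]]]].
      by exists 0, h; rewrite add0r.
    by apply/scroll_idealP/minor_idealE; exists w; rewrite add0r.
  - by move=> w; apply: hilbert_burch_exact1; apply: scroll_minors_independent.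
  - move=> w; split=> [/(hilbert_burch_exact2 (minor3_neq0 k) (xN0 3)) ->|[y ->]].
      by exists 0; rewrite mul0mx.
    by rewrite mulmx0 mul0mx.
  - by move=> w; split=> _; [exists 0; rewrite mulmx0 thinmx0 | rewrite mulmx0].
  - by move=> w _; rewrite thinmx0.
exact: pure_minimal.
Qed.

Lemma has_minimal_resolution_ext (I : R -> Prop) b b' :
  (forall i e, b i e = b' i e) -> has_minimal_resolution I b -> has_minimal_resolution I b'.
Proof. by move=> eb [F [resF minF cF]]; exists F; split=> // i e; rewrite cF. Qed.

(** Putting s = x0, t = x1, u = 1, v = 0 in phi f gives f(x0, x1, 0, 0, 0), and f differs from this
    by an element of (x2, x3, x4). *)
Lemma kill_v_to_cox f : kill_var (inord 3) (phi f) = 0 ->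
  exists a b c, f = a * x 2 + b * x 3 + c * x 4.
Proof.
pose I (g : R) := exists a b c, g = a * x 2 + b * x 3 + c * x 4.
have idI : is_ideal I.
  split; first by exists 0, 0, 0; rewrite !mul0r !addr0.
    by move=> _ _ [a [b [c ->]]] [a' [b' [c' ->]]]; exists (a + a'), (b + b'), (c + c'); ring.
  by move=> g _ [a [b [c ->]]]; exists (g * a), (g * b), (g * c); ring.
move=> f0; pose l := [tuple x 0; x 1; 0; 0; 0].
have fl : f \mPo l = 0.
  pose lr := [tuple x 0; x 1; 1; 0].
  have e0 : s \mPo lr = x 0 by rewrite comp_mpolyXU inordK.
  have e1 : t \mPo lr = x 1 by rewrite comp_mpolyXU inordK.
  have e2 : u \mPo lr = 1 by rewrite comp_mpolyXU inordK.
  have kill_phi : kill_var (inord 3) (phi f) = f \mPo scroll_map s t u 0.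
    rewrite /kill_var /to_cox comp_scroll_map -!/(kill_var _ _).
    by rewrite !kill_inord.
  have := comp_scroll_map f s t u 0 lr.
  rewrite -kill_phi f0 !comp_mpoly0 e0 e1 e2 => e; rewrite [RHS]e; congr (_ \mPo _).
  by apply/val_inj; rewrite /= !mulr1 !mulr0.
suff : I (f - (f \mPo l)) by rewrite fl subr0.
apply: (ideal_subst f idI) => i; rewrite -(inord_val i) (tnth_nth 0) inordK ?ltn_ord //.
case: i => -[|[|[|[|[|]]]]] //= _; rewrite ?subrr ?subr0; try exact: ideal0.
- by exists 1, 0, 0; rewrite mul1r !mul0r !addr0.
- by exists 0, 1, 0; rewrite mul1r !mul0r addr0 add0r.
by exists 0, 0, 1; rewrite mul1r !mul0r !add0r.
Qed.

Lemma reg2 i j : (i < 5)%N -> (j < 5)%N -> i != j -> regular2 (x i) (x j).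
Proof. by move=> li lj ne; apply: regular2_vars; rewrite eq_inord. Qed.

Lemma reg3 i j l : (i < 5)%N -> (j < 5)%N -> (l < 5)%N -> i != j -> i != l -> j != l ->
  regular3 (x i) (x j) (x l).
Proof. by move=> li lj ll ij il jl; apply: regular3_vars; rewrite eq_inord. Qed.

Lemma mulmx_scalar00 (w : 'rV[R]_1) f : (w *m f%:M) 0 0 = w 0 0 * f.
Proof. by rewrite mul_mx_scalar mxE mulrC. Qed.

Lemma graded_scalar d f : f \is d.-homog ->
  graded_mx (fun _ => d) (fun _ => 0%N) (f%:M : 'cV[R]_1).
Proof.
move=> hf; apply: (graded_const (c := d)); first by rewrite addn0.
by move=> i j; rewrite (ord1 i) (ord1 j) !mxE eqxx mulr1n.
Qed.

Lemma cox_lift (G : T) (a b : nat) y (c : nat) : weight_homog Hwt a%:Z G ->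
  weight_homog Fwt b%:Z G -> weight_homog Hwt c%:Z y -> weight_homog Fwt (- b%:Z) y ->
  exists2 f, phi f = G * y & f \is (a + c).-homog.
Proof.
move=> hG fG hy fy; have := weight_homogM FwtD fG fy.
rewrite subrr => /to_cox_surj[f ef hf]; exists f => //; apply: hf.
by rewrite PoszD; apply: (weight_homogM HwtD hG hy).
Qed.

Lemma pow_weight (y : T) w1 w2 d : weight_homog Hwt w1 y -> weight_homog Fwt w2 y ->
  weight_homog Hwt (w1 *+ d) (y ^+ d) /\ weight_homog Fwt (w2 *+ d) (y ^+ d).
Proof.
by move=> h1 h2; split; [apply: (weight_homog_exp HwtD h1) | apply: (weight_homog_exp FwtD h2)].
Qed.

(* V(v G) is contained in V(G), and the quotient is generated by the class of a
   form f0 mapped to G u^b, with annihilator the ideal (x2, x3, x4) of the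
   directrix v = 0. *)
Lemma resolution_step a b (G : T) bJ : G != 0 ->
  weight_homog Hwt a%:Z G -> weight_homog Fwt b%:Z G ->
  has_minimal_resolution (cox_ideal (v * G)) bJ ->
  (forall i, bJ i (a + b + i.+1)%N = 0%N) ->
  has_minimal_resolution (cox_ideal G)
    (fun i e => bJ i e + row_total (a + b) [:: 1; 3; 3; 1] i e)%N.
Proof.
move=> nzG hG fG resJ disj.
have [[[_ _] hu] hv] := @Hwt_var k; have [[[_ _] fu] fv] := @Fwt_var k.
have [hub fub] := pow_weight b hu fu.
have [f0 ef0 hf0] : exists2 f, phi f = G * u ^+ b & f \is (a + b).-homog.
  by apply: cox_lift hG fG _ _; [rewrite natz in hub | rewrite mulNrn natz in fub].
pose e i := (a + b + i)%N.
have es i : (e i < e i.+1)%N by rewrite /e addnS.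
pose N := @pure_cpx k 5 1 3 3 1 e (koszul0 (x 2) (x 3) (x 4)) (koszul1 (x 2) (x 3) (x 4))
  (koszul2 (x 2) (x 3) (x 4)) f0%:M.
have gA : graded_mx (fun _ => e 0%N) (fun _ => 0%N) (f0%:M : 'cV[R]_1).
  by rewrite /e addn0; apply: graded_scalar.
have g0 : graded_mx (fun _ => e 1%N) (fun _ => e 0%N) (koszul0 (x 2) (x 3) (x 4)).
  apply: (graded_const (c := 1%N)); first by rewrite /e addn0 addn1.
  by apply: dhomog_seqmx; rewrite /= !dhomog_var.
have g1 : graded_mx (fun _ => e 2%N) (fun _ => e 1%N) (koszul1 (x 2) (x 3) (x 4)).
  apply: (graded_const (c := 1%N)); first by rewrite /e addnS.
  by apply: dhomog_seqmx; rewrite /= !rpredN !rpred0 !dhomog_var.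
have g2 : graded_mx (fun _ => e 3%N) (fun _ => e 2%N) (koszul2 (x 2) (x 3) (x 4)).
  apply: (graded_const (c := 1%N)); first by rewrite /e addnS.
  by apply: dhomog_seqmx; rewrite /= !rpredN !dhomog_var.
apply: (horseshoe_minimal (N := N) resJ); last 3 first.
- exact: pure_minimal.
- by move=> i d; rewrite card_pure.
- by move=> i d; rewrite /row_total; have [<- _|//] := eqVneq (a + b + i.+1)%N d; apply: disj.
apply: pure_relative_resolution => //.
- move=> f; split=> [[C eC]|[j [w [[C eC] ->]]]]; last first.
    rewrite mulmx_scalar00; exists (v * C + u ^+ b * phi (w 0 0)).
    by rewrite to_coxD to_coxM eC ef0; ring.
  have fC : weight_homog Fwt (- b%:Z) C := cofactor_Fwt nzG fG eC.
  (* Monomials of C containing v go into C'. One without v has u-exponent b plus its degree in s and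
     t, so u^b divides it with quotient of F-weight 0. *)
  have [C' [c [c0 ec]]] : exists C' c, weight_homog Fwt 0 c /\ C = v * C' + u ^+ b * c.
    apply: (mpoly_supp_ind (p := C) (Q := fun D => exists C' c, weight_homog Fwt 0 c /\
        D = v * C' + u ^+ b * c)).
    - by exists 0, 0; split; [move=> m; rewrite msupp0 | rewrite !mulr0 addr0].
    - move=> _ _ [C1 [c1 [h1 ->]]] [C2 [c2 [h2 ->]]]; exists (C1 + C2), (c1 + c2).
      split; last by ring.
      by move=> m /msuppD_le; rewrite mem_cat => /orP[/h1|/h2].
    move=> m /fC; have [p [q [i [j ->]]]] := mn4_ex m; rewrite /Fwt !mn4E.
    case: j => [|j] em; last first.
      exists (C@_(mn4 p q i j.+1) *: 'X_[mn4 p q i j]), 0.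
      split; first by move=> m'; rewrite msupp0.
      by rewrite mulr0 addr0 !mpolyX_mn4 exprS -scalerAr; congr (_ *: _); ring.
    exists 0, (C@_(mn4 p q i 0) *: 'X_[mn4 p q (i - b) 0]); split.
      by move=> m' /msuppZ_le /mem_msuppXP <-; rewrite /Fwt !mn4E; lia.
    rewrite mulr0 add0r !mpolyX_mn4 -scalerAr; congr (_ *: _).
    have ei : i = (b + (i - b))%N by lia.
    by rewrite {1}ei exprD; ring.
  have [g eg _] := to_cox_surj c0.
  exists (f - g * f0), (g%:M); split; last by rewrite mulmx_scalar00 !mxE eqxx mulr1n subrK.
  by exists C'; rewrite to_coxB to_coxM eC ec eg ef0; ring.
- move=> w; rewrite mulmx_scalar00; split=> [[C eC]|[y ew]].
    have e1 : phi (w 0 0) * u ^+ b = v * C.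
      by apply: (mulfI nzG); rewrite [RHS]mulrCA [RHS]mulrA -eC to_coxM ef0 mulrCA.
    have /kill_v_to_cox[a' [b' [c' ew]]] : kill_var (inord 3) (phi (w 0 0)) = 0.
      have /eqP := congr1 (kill_var (inord 3)) e1; rewrite !killE !kill_inord //= mul0r.
      by rewrite mulf_eq0 expf_eq0 (negbTE (mpolyX_neq0 _ _)) andbF orbF => /eqP.
    exists (rowl 3 [:: a'; b'; c']); apply/mx11P.
    by rewrite ew !mxE !big_ord_recl big_ord0 !mxE /= addr0 addrA.
  have [l sl ey] := rowl_ex y; case: l sl ey => [|a' [|b' [|c' [|? ?]]]] // _ ey.
  exists ((phi a' * s ^+ 2 + phi b' * (s * t) + phi c' * t ^+ 2) * u ^+ b).
  have -> : w 0 0 = a' * x 2 + b' * x 3 + c' * x 4.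
    by rewrite ew ey !mxE !big_ord_recl big_ord0 !mxE /= addr0 addrA.
  by rewrite !(to_coxD, to_coxM) ef0 !to_cox_var; ring.
- move=> w; rewrite -koszul_exact1 ?xN0 //.
    by split=> [->|e0]; [rewrite mxE | apply/mx11P; rewrite e0 mxE].
    exact: reg2.
  exact: reg3.
- by move=> w; apply: koszul_exact2; [apply: xN0 | apply: reg2].
- by move=> w; apply: koszul_exact3; apply: xN0.
Qed.


(** G lifts to a form g of degree a, so V(G) = I(S) + (g). Multiplication by g is injective on R /
    I(S), hence the Hilbert-Burch complex shifted by a resolves the quotient. Positivity of a keeps
    its first syzygies, of degree a + 2, apart from the quadrics of I(S). *)
Lemma resolution_base0 a (G : T) : (0 < a)%N -> G != 0 ->
  weight_homog Hwt a%:Z G -> weight_homog Fwt 0 G ->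
  has_minimal_resolution (cox_ideal G)
    (fun i e => row_total 2 [:: 3; 2; 0; 0] i e + (row_total a [:: 1; 0; 0; 0] i e
                + row_total a.+1 [:: 0; 3; 2; 0] i e))%N.
Proof.
move=> a0 nzG hG fG; have [g eg hg] := to_cox_surj fG.
(* The extra 1 for positive i reflects that the first differential consists of quadrics. *)
pose e i := (a + i + (0 < i))%N.
have es i : (e i < e i.+1)%N by rewrite /e; lia.
pose N := @pure_cpx k 5 1 3 2 0 e minors hb 0 g%:M.
have gA : graded_mx (fun _ => e 0%N) (fun _ => 0%N) (g%:M : 'cV[R]_1).
  by rewrite /e !addn0; apply/graded_scalar/hg.
have g0 : graded_mx (fun _ => e 1%N) (fun _ => e 0%N) minors.
  by rewrite /e !addn0 !addn1; apply: minors_graded.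
have g1 : graded_mx (fun _ => e 2%N) (fun _ => e 1%N) hb.
  by rewrite /e !addn1 addn2; apply: hb_graded.
have g2 : graded_mx (fun _ => e 3%N) (fun _ => e 2%N) (0 : 'M[R]_(0, 2)) by apply: graded_mx0.
apply: (horseshoe_minimal (N := N) scroll_ideal_resolution); last 3 first.
- exact: pure_minimal.
- move=> i d; rewrite card_pure /row_total /e /pure_rk.
  by case: i => [|[|[|[|i]]]] /=; rewrite ?nth_nil; do 3?case: eqP => //=; lia.
- move=> i d; rewrite /row_total.
  have -> : nth 0%N [:: 1; 0; 0; 0]%N i.+1 = 0%N by case: i => [|[|[|i]]] //=; rewrite nth_nil.
  rewrite if_same add0n; have [<- _|//] := eqVneq (a.+1 + i.+1)%N d.
  by case: eqP => //; lia.
apply: pure_relative_resolution => //.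
- move=> f; split=> [[C eC]|[j [w [j0 ->]]]]; last first.
    apply: (idealD (cox_idealP G)); first exact: scroll_sub_cox_ideal.
    by exists (phi (w 0 0)); rewrite mulmx_scalar00 to_coxM eg mulrC.
  have := cofactor_Fwt nzG fG eC; rewrite oppr0 => /to_cox_surj[c ec _].
  exists (f - c * g), (c%:M); split; last by rewrite mulmx_scalar00 !mxE eqxx mulr1n subrK.
  by apply: to_cox_eq0; rewrite to_coxB to_coxM eC ec eg mulrC subrr.
- move=> w; rewrite mulmx_scalar00.
  have -> : scroll_ideal (w 0 0 * g) <-> scroll_ideal (w 0 0).
    split=> e0; last by rewrite mulrC; apply: (idealM _ (scroll_ideal_is_ideal k)).
    apply: to_cox_eq0; apply: (mulIf nzG); rewrite mul0r -eg -to_coxM; exact: e0.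
  split=> [/scroll_idealP/minor_idealE[h eh]|[h eh]]; last first.
    by apply/scroll_idealP/minor_idealE; exists h; rewrite eh.
  by exists h; apply/mx11P.
- move=> w; rewrite -(hilbert_burch_exact1 _ (@scroll_minors_independent k)).
  by split=> [->|e0]; [rewrite mxE | apply/mx11P; rewrite e0 mxE].
- move=> w; split=> [/(hilbert_burch_exact2 (minor3_neq0 k) (xN0 3)) ->|[y ->]].
    by exists 0; rewrite mul0mx.
  by rewrite mulmx0 mul0mx.
by move=> w _; rewrite thinmx0.
Qed.

(* Here V(G) / I(S) is isomorphic to the ideal of a ruling line in S: the
   generators mapped to G u, G s v, G t v correspond to x0, x2, x3. *)
Lemma resolution_base1 a (G : T) : (0 < a)%N -> G != 0 ->
  weight_homog Hwt a%:Z G -> weight_homog Fwt 1 G ->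
  has_minimal_resolution (cox_ideal G)
    (fun i e => row_total 2 [:: 3; 2; 0; 0] i e + row_total a.+1 [:: 3; 6; 3; 0] i e)%N.
Proof.
move=> a0 nzG hG fG.
have [[[hs ht] hu] hv] := @Hwt_var k; have [[[fs ft] fu] fv] := @Fwt_var k.
have [f0 ef0 hf0] : exists2 f, phi f = G * u & f \is (a + 1).-homog by apply: cox_lift hG fG _ _.
have [f2 ef2 hf2] : exists2 f, phi f = G * (s * v) & f \is (a + 1).-homog.
  apply: cox_lift hG fG _ _; first exact: (weight_homogM HwtD hs hv).
  exact: (weight_homogM FwtD fs fv).
have [f3 ef3 hf3] : exists2 f, phi f = G * (t * v) & f \is (a + 1).-homog.
  apply: cox_lift hG fG _ _; first exact: (weight_homogM HwtD ht hv).
  exact: (weight_homogM FwtD ft fv).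
pose e i := (a.+1 + i)%N.
have es i : (e i < e i.+1)%N by rewrite /e addnS.
pose A : 'cV[R]_3 := seqmx 3 1 [:: [:: f0]; [:: f2]; [:: f3]].
pose D0 := cone_mx0 (x 0) (x 1) (x 2) (x 3) (x 4).
pose D1 := cone_mx1 (x 0) (x 1) (x 2) (x 3) (x 4).
pose N := @pure_cpx k 5 3 6 3 0 e D0 D1 0 A.
have gA : graded_mx (fun _ => e 0%N) (fun _ => 0%N) A.
  apply: (graded_const (c := (a + 1)%N)); first by rewrite /e !addn0 addn1.
  by apply: dhomog_seqmx; rewrite /= hf0 hf2 hf3.
have g0 : graded_mx (fun _ => e 1%N) (fun _ => e 0%N) D0.
  apply: (graded_const (c := 1%N)); first by rewrite /e addn0 addn1.
  by apply: dhomog_seqmx; rewrite /= !rpredN !rpred0 !dhomog_var.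
have g1 : graded_mx (fun _ => e 2%N) (fun _ => e 1%N) D1.
  apply: (graded_const (c := 1%N)); first by rewrite /e addnS.
  by apply: dhomog_seqmx; rewrite /= !rpredN !rpred0 !dhomog_var.
have g2 : graded_mx (fun _ => e 3%N) (fun _ => e 2%N) (0 : 'M[R]_(0, 3)) by apply: graded_mx0.
have wA a' b' c' : (rowl 3 [:: a'; b'; c'] *m A) 0 0 = a' * f0 + b' * f2 + c' * f3.
  by rewrite !mxE !big_ord_recl big_ord0 !mxE /= addr0 addrA.
have wK a' b' c' : (rowl 3 [:: a'; b'; c'] *m koszul0 (x 0) (x 2) (x 3)) 0 0 =
    a' * x 0 + b' * x 2 + c' * x 3.
  by rewrite !mxE !big_ord_recl big_ord0 !mxE /= addr0 addrA.
have phiA a' b' c' : phi (a' * f0 + b' * f2 + c' * f3) =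
    G * (phi a' * u + phi b' * (s * v) + phi c' * (t * v)).
  by rewrite !(to_coxD, to_coxM) ef0 ef2 ef3; ring.
apply: (horseshoe_minimal (N := N) scroll_ideal_resolution); last 3 first.
- exact: pure_minimal.
- by move=> i d; rewrite card_pure.
- move=> i d; rewrite /row_total; have [<- _|//] := eqVneq (a.+1 + i.+1)%N d.
  by case: eqP => //; lia.
have r02 := @reg2 0 2 isT isT isT; have r23 := @reg2 2 3 isT isT isT.
have r023 := @reg3 0 2 3 isT isT isT isT isT isT.
have ind := @scroll_minors_independent k.
apply: pure_relative_resolution => //.
- move=> f; split=> [[C eC]|[j [w [j0 ->]]]]; last first.
    apply: (idealD (cox_idealP G)); first exact: scroll_sub_cox_ideal.
    have [l sl ->] := rowl_ex w; case: l sl => [|a' [|b' [|c' [|? ?]]]] // _.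
    by rewrite wA; eexists; apply: phiA.
  have fC : weight_homog Fwt (-1) C := cofactor_Fwt nzG fG eC.
  (* A monomial of F-weight -1 without u has odd degree 2j - 1 in s and t, where j is its
     v-exponent; so it is divisible by s v or by t v. *)
  have [a' [b' [c' ec]]] : exists a' b' c' : R,
      C = phi a' * u + phi b' * (s * v) + phi c' * (t * v).
    apply: (mpoly_supp_ind (p := C) (Q := fun D => exists a' b' c' : R,
      D = phi a' * u + phi b' * (s * v) + phi c' * (t * v))).
    - by exists 0, 0, 0; rewrite to_cox0 !mul0r !addr0.
    - move=> _ _ [a1 [b1 [c1 ->]]] [a2 [b2 [c2 ->]]]; exists (a1 + a2), (b1 + b2), (c1 + c2).
      by rewrite !to_coxD; ring.
    move=> m /fC; set c := C@_m; have [p [q [i [j ->]]]] := mn4_ex m; rewrite /Fwt !mn4E => em.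
    have lift (m' : 'X_{1..4}) : Fwt m' = 0 -> exists f', phi f' = c *: 'X_[m'].
      move=> fm'; exists (c *: 'X_[cox_std m']).
      by rewrite to_coxZ to_coxX cox_expK.
    case: i em => [|i] em; last first.
      have [|f' ef'] := lift (mn4 p q i j); first by rewrite /Fwt !mn4E; lia.
      exists f', 0, 0; rewrite ef' to_cox0 !mul0r !addr0 -scalerAl; congr (_ *: _).
      by rewrite !mpolyX_mn4 exprS; ring.
    case: j em => [|j] em; first by exfalso; lia.
    case: p em => [|p] em.
      case: q em => [|q] em; first by exfalso; lia.
      have [|f' ef'] := lift (mn4 0 q 0 j); first by rewrite /Fwt !mn4E; lia.
      exists 0, 0, f'; rewrite ef' to_cox0 !mul0r !add0r -scalerAl; congr (_ *: _).
      by rewrite !mpolyX_mn4 !exprS; ring.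
    have [|f' ef'] := lift (mn4 p q 0 j); first by rewrite /Fwt !mn4E; lia.
    exists 0, f', 0; rewrite ef' to_cox0 !mul0r addr0 add0r -scalerAl; congr (_ *: _).
    by rewrite !mpolyX_mn4 !exprS; ring.
  exists (f - (a' * f0 + b' * f2 + c' * f3)), (rowl 3 [:: a'; b'; c']).
  by rewrite wA subrK; split=> //; apply: to_cox_eq0; rewrite to_coxB phiA eC ec subrr.
- move=> w; rewrite -cone_exact0 ?xN0 //.
  have [l sl ->] := rowl_ex w; case: l sl => [|a' [|b' [|c' [|? ?]]]] // _.
  rewrite wA wK -minor_idealE -scroll_idealP.
  (* Multiplication by s sends u, s v, t v to the pullbacks of x0, x2, x3, which identifies
     relations modulo I(S) on both sides. *)
  have e1 : phi (a' * x 0 + b' * x 2 + c' * x 3) =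
      s * (phi a' * u + phi b' * (s * v) + phi c' * (t * v)).
    by rewrite !(to_coxD, to_coxM) !to_cox_var; ring.
  have nzs : s != 0 := mpolyX_neq0 k _.
  split=> e0; apply: to_cox_eq0; rewrite ?phiA ?e1.
    by apply: (mulfI nzG); rewrite mulr0 mulrCA -phiA [phi _]e0 mulr0.
  by apply: (mulfI nzs); rewrite mulr0 mulrCA -e1 [phi _]e0 mulr0.
- by move=> w; apply: cone_exact1.
- move=> w; split=> [/(cone_exact2 (xN0 3) (minor3_neq0 k)) ->|[y ->]].
    by exists 0; rewrite mul0mx.
  by rewrite mulmx0 mul0mx.
by move=> w _; rewrite thinmx0.
Qed.

(** Here b = 2 delta + odd_b. For even b the row (1,6,5,1) of the final table appears split into
    (0,3,2,0) from the base case and (1,3,3,1) from a Koszul complex; hence the sum starts at delta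
    + 1 for even b and at delta + 2 for odd b. *)
Definition scroll_betti (odd_b : bool) (delta a i e : nat) : nat :=
  (row_total 2 [:: 3; 2; 0; 0] i e
   + (if odd_b then row_total (a + delta).+1 [:: 3; 6; 3; 0] i e
      else row_total (a + delta) [:: 1; 0; 0; 0] i e
           + row_total (a + delta).+1 [:: 0; 3; 2; 0] i e)
   + \sum_(delta.+1 + odd_b <= l < (delta.*2 + odd_b).+1)
       row_total (a + l) [:: 1; 3; 3; 1] i e)%N.

(** Replacing (a, delta + 1) by (a + 1, delta) keeps a + delta, so the base rows stay in place, and
    the reindexed sum loses exactly its last term. *)
Lemma scroll_betti_step (ob : bool) delta a i e :
  scroll_betti ob delta.+1 a i e =
  (scroll_betti ob delta a.+1 i e + row_total (a + (delta.+1.*2 + ob)) [:: 1; 3; 3; 1] i e)%N.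
Proof.
have ea : (a.+1 + delta = a + delta.+1)%N := addSnnS a delta.
have e1 : (delta.+1.*2 + ob = (delta.*2 + ob).+2)%N by rewrite doubleS !addSn.
rewrite /scroll_betti ea e1 -!addnA addSn; do 2! congr (_ + _)%N.
rewrite big_add1 /= big_nat_recr /=; last by case: (ob); lia.
by congr (_ + _)%N; apply: eq_bigr => l _; rewrite addSnnS.
Qed.

(** With b = 2 (delta + 1) + ob, the degree in question belongs to row a + b + 1, while all rows of
    the smaller table are at most a + b. *)
Lemma scroll_betti_disj (ob : bool) delta a i :
  scroll_betti ob delta a.+1 i (a + (delta.+1.*2 + ob) + i.+1)%N = 0%N.
Proof.
have row0 l r e : (l + i != e)%N -> row_total l r i e = 0%N.
  by rewrite /row_total => /negbTE ->.
rewrite /scroll_betti row0; last by rewrite doubleS; lia.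
rewrite big_nat big1 => [|l /andP[_ lt_l]]; last first.
  by apply: row0; rewrite doubleS; lia.
rewrite addn0 add0n; case: ob; rewrite !row0 //; rewrite doubleS -muln2; lia.
Qed.

(** The hypothesis on a + delta is invariant under the induction step and becomes 0 < a in the base
    case. *)
Lemma cox_ideal_resolution (ob : bool) delta a (G : T) : (0 < a + delta)%N -> G != 0 ->
  weight_homog Hwt a%:Z G -> weight_homog Fwt (delta.*2 + ob)%N%:Z G ->
  has_minimal_resolution (cox_ideal G) (scroll_betti ob delta a).
Proof.
elim: delta a G => [|delta IH] a G a0 nzG hG fG.
  rewrite addn0 in a0; case: ob fG => fG.
    apply: has_minimal_resolution_ext (resolution_base1 a0 nzG hG fG) => i e.
    by rewrite /scroll_betti big_geq // !addn0.
  apply: has_minimal_resolution_ext (resolution_base0 a0 nzG hG fG) => i e.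
  by rewrite /scroll_betti big_geq // !addn0.
have [[[_ _] _] hv] := @Hwt_var k; have [[[_ _] _] fv] := @Fwt_var k.
apply: (has_minimal_resolution_ext (fun i e => esym (scroll_betti_step ob delta a i e))).
apply: (resolution_step nzG hG fG) => [|i]; last exact: scroll_betti_disj.
apply: IH => //; first by rewrite mulf_neq0 ?mpolyX_neq0.
  have := weight_homogM HwtD hv hG; rewrite (_ : 1 + a%:Z = a.+1%:Z) //; lia.
have := weight_homogM FwtD fv fG.
rewrite (_ : -2 + (delta.+1.*2 + ob)%N%:Z = (delta.*2 + ob)%N%:Z) // doubleS; lia.
Qed.

Lemma row_total_at l r0 r1 r2 r3 i j :
  row_total l [:: r0; r1; r2; r3] i (i + j) = row_at l [tuple r0; r1; r2; r3] i j.
Proof. by rewrite /row_total /row_at addnC eqn_add2l eq_sym. Qed.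

Lemma row_total_ge4 l r0 r1 r2 r3 i e : (4 <= i)%N -> row_total l [:: r0; r1; r2; r3] i e = 0%N.
Proof. by move=> le4i; rewrite /row_total nth_default ?if_same. Qed.

Lemma graded_free_resolution_ext (I J : R -> Prop) F : (forall f, I f <-> J f) ->
  graded_free_resolution I F -> graded_free_resolution J F.
Proof. by move=> eIJ [ga gd eI e0 eS]; split=> // f; rewrite -eIJ. Qed.

End Resolutions.

Local Close Scope ring_scope.

Theorem theorem1p2 (k : closedFieldType) (a b : nat) (X : {mpoly k[5]} -> Prop)
    (hab : (a = 0 /\ 3 <= b) \/ (1 <= a /\ 2 <= b))
    (hX : effective_divisor X) (hXab : lin_equiv X (div_aH_bF a b)) :
  exists B : nat -> nat -> nat,
    [/\ is_betti_table X B,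
        (forall delta : nat, b = 2 * delta ->
           forall i j : nat,
             B i j = row_at 2 [tuple 3; 2; 0; 0] i j
                     + row_at (a + delta) [tuple 1; 0; 0; 0] i j
                     + row_at (a + delta + 1) [tuple 1; 6; 5; 1] i j
                     + \sum_(delta + 2 <= l < b.+1)
                         row_at (a + l) [tuple 1; 3; 3; 1] i j),
        (forall delta : nat, b = 2 * delta + 1 ->
           forall i j : nat,
             B i j = row_at 2 [tuple 3; 2; 0; 0] i j
                     + row_at (a + delta + 1) [tuple 3; 6; 3; 0] i j
                     + \sum_(delta + 2 <= l < b.+1)
                         row_at (a + l) [tuple 1; 3; 3; 1] i j)
      & (forall i j : nat, 4 <= i -> B i j = 0)].
Proof.
have [G [nzG hG fG eX]] := effective_divisor_equation hX hXab.
(* Both alternatives of the hypothesis give b >= 2, so delta is positive; this yields a + delta > 0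
   even for a = 0. *)
have b_ge2 : 1 < b by case: hab => -[_ //] /ltnW.
have eb : b = b./2.*2 + odd b by rewrite addnC odd_double_half.
have hl : 0 < b./2 by case: (b./2) eb b_ge2 => [|//] ->; case: (odd b).
have ad0 : 0 < a + b./2 by rewrite addn_gt0 hl orbT.
rewrite [in Posz _]eb in fG.
have [F [resF minF cF]] := cox_ideal_resolution ad0 nzG hG fG.
have resX := graded_free_resolution_ext (fun f => iff_sym (eX f)) resF.
exists (fun i j => scroll_betti (odd b) b./2 a i (i + j)); split.
- by apply: betti_table_of_minimal resX minF _ => i j; rewrite cF.
- move=> d ed i j; have eodd : odd b = false by rewrite ed mul2n odd_double.
  have ehalf : b./2 = d by rewrite ed mul2n doubleK.
  rewrite eodd ehalf /scroll_betti !row_total_at addn0 addn1.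
  (* The first Koszul row, l = delta + 1, is split off to be merged with (0,3,2,0) into (1,6,5,1);
     it exists because delta > 0. *)
  rewrite big_ltn; last by rewrite addn0 ltnS -addnn -[X in X < _]addn0 ltn_add2l -ehalf.
  rewrite addn0 -mul2n -ed addn2 addnS.
  under eq_bigr => l _ do rewrite row_total_at.
  rewrite row_total_at -!addnA; congr (_ + (_ + _)); rewrite !addnA; congr (_ + _).
  rewrite /row_at; case: eqP => // _.
  by case: i => [|[|[|[|i]]]] //=; rewrite nth_nil.
- move=> d ed i j; have eodd : odd b by rewrite ed mul2n addn1 /= odd_double.
  have ehalf : b./2 = d by rewrite ed mul2n addn1 /= uphalf_double.
  have eb1 : d.*2 + true = b by rewrite ed mul2n.
  rewrite eodd ehalf /scroll_betti !row_total_at eb1 !addn1 addn2.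
  by congr (_ + _); apply: eq_bigr => l _; rewrite row_total_at.
move=> i j le4i; rewrite /scroll_betti !row_total_ge4 // if_same big1 // => l _.
exact: row_total_ge4.
Qed.
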